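(* For every $s\in\omega$, $\textnormal{ASI}(s)\subseteq\textnormal{asi}(s)$. That is, if a coloring problem $(\Pi,\Gamma)$ is solved by some ASI-$s$ algorithm, then every Borel structured graph $G\in\Gamma$ with $\textnormal{asi}(G)\le s$ admits a Borel $\Pi$-coloring.
   Context: All graphs are locally finite. HF denotes the set of hereditarily finite sets, with the discrete topology. A structured graph is a structure in a finite language extending the language of graphs (one binary adjacency relation, interpreted symmetrically and irreflexively). A coloring problem $(\Pi,\Gamma)$ consists of a class $\Gamma$ of structured graphs, closed under isomorphism and such that $G\in\Gamma$ iff every connected component of $G$ is in $\Gamma$, and a class $\Pi$ of functions $V(G)\to\textnormal{HF}$ ($G\in\Gamma$) (called $\Pi$-colorings), closed under pushforward by isomorphisms and such that $c\in\Pi$ iff its restriction to each component is in $\Pi$. An ASI-$s$ algorithm is a function $\mathcal{A}$ which, on input $(H,<,U_0,\dots,U_s,C)$ where $H$ is a finite structured graph, $<$ a linear order on $V(H)$, $U_0,\dots,U_s$ a partition of $V(H)$, and $C\subseteq V(H)$, returns a function $C\to\textnormal{HF}$, such that for any isomorphism $\phi$ of such input structures, $\mathcal{A}(\text{input})=\mathcal{A}(\phi(\text{input}))\circ(\phi\upharpoonright C)$. For a structured graph $G$ with path metric $\rho_G$ and $r\in\omega$, $G^r$ is the graph on $V(G)$ joining distinct $x,y$ with $\rho_G(x,y)\le r$. An ASI-$s$ witness for $G$ with scale $r$ is a partition $U_0,\dots,U_s$ of $V(G)$ such that every connected component of each $G^r\upharpoonright U_i$ is finite. Given such a witness and a linear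 order $<$ on $V(G)$, let $\mathcal{C}$ be the disjoint set of all components of all $G^r\upharpoonright U_i$, and $\tilde G$ the graph on $\mathcal{C}$ joining $C\neq D$ when $\rho_G(C,D)\le r$. For $n\in\omega$, $\mathcal{A}_n[(G,<,U_0,\dots,U_s)]$ colors each $C\in\mathcal{C}$ by $\mathcal{A}(G\upharpoonright W,<\upharpoonright W,U_0\cap W,\dots,U_s\cap W,C)$, where $W=\bigcup\{D\in\mathcal{C}:\rho_{\tilde G}(C,D)\le n\}$. $(\Pi,\Gamma)\in\textnormal{ASI}(s)$ if there are an ASI-$s$ algorithm $\mathcal{A}$ and $n,r\in\omega$ such that for every $G\in\Gamma$, every linear order $<$ on $V(G)$ and every ASI-$s$ witness for $G$ with scale $r$, $\mathcal{A}_n[(G,<,U_0,\dots,U_s)]\in\Pi$. A structured graph is Borel if its vertex set is a Polish space and all its relations are Borel; a coloring $V(G)\to\textnormal{HF}$ is Borel if it is Borel as a function. For a locally finite Borel graph $G$, $\textnormal{asi}(G)$ (asymptotic separation index) is the least $s\in\omega$ such that for every $r\in\omega$, $G$ admits an ASI-$s$ witness with scale $r$ consisting of Borel sets, or $\infty$ if none exists (for structured graphs this refers to the underlying graph). A coloring problem $(\Pi,\Gamma)$ is in the class $\textnormal{asi}(s)$ if every Borel $G\in\Gamma$ with $\textnormal{asi}(G)\le s$ admits a Borel $\Pi$-coloring. *)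

(* Defs.v *)
From HB Require Import structures.
From mathcomp Require Import all_boot all_order all_algebra generic_quotient.
From mathcomp Require Import all_classical all_reals all_analysis.

Set Implicit Arguments.
Unset Strict Implicit.
Unset Printing Implicit Defensive.

Local Open Scope classical_set_scope.

(* A finite rooted tree denotes the set of the sets denoted by its immediate
   subtrees; HF is the quotient by "denotes the same set". *)
Inductive hftree := HFNode of seq hftree.

Fixpoint hftree_encode (t : hftree) : GenTree.tree void :=
  let: HFNode s := t in GenTree.Node 0 (map hftree_encode s).

Fixpoint hftree_decode (t : GenTree.tree void) : hftree :=
  if t is GenTree.Node _ s then HFNode (map hftree_decode s) else HFNode [::].

Lemma hftree_ind_nested (P : hftree -> Prop) :
  (forall s, (forall i, i < size s -> P (nth (HFNode [::]) s i)) ->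
    P (HFNode s)) ->
  forall t, P t.
Proof.
move=> IH; fix rec 1 => -[s]; apply: IH.
elim: s => [|t s IHs]; first by clear rec.
by move=> [_|i]; [exact: (rec t) | exact: IHs].
Qed.

Lemma hftree_encodeK : cancel hftree_encode hftree_decode.
Proof.
elim/hftree_ind_nested => s IH /=; congr HFNode; rewrite -map_comp.
apply: (@eq_from_nth _ (HFNode [::])) => [|i]; rewrite size_map// => lti.
by rewrite (nth_map (HFNode [::]))//= IH.
Qed.

HB.instance Definition _ := Countable.copy hftree (can_type hftree_encodeK).

Fixpoint hfeq (t u : hftree) {struct t} : bool :=
  let: HFNode s := t in let: HFNode s' := u in
  all (fun x => has (hfeq x) s') s && all (fun y => has (hfeq^~ y) s) s'.

Lemma hftree_ind_mem (P : hftree -> Prop) :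
  (forall s, {in s, forall t, P t} -> P (HFNode s)) -> forall t, P t.
Proof.
move=> IH; elim/hftree_ind_nested => s IHs; apply: IH => t.
by move=> /(nthP (HFNode [::]))[i lti <-]; exact: IHs.
Qed.

Lemma hfeqP s s' : reflect
  ({in s, forall x, exists2 y, y \in s' & hfeq x y} /\
   {in s', forall y, exists2 x, x \in s & hfeq x y})
  (hfeq (HFNode s) (HFNode s')).
Proof.
apply: (iffP andP) => -[].
  by move=> /allP h /allP h'; split=> x /[dup] xs; [move/h|move/h'] => /hasP.
by move=> h h'; split; apply/allP => x xs; apply/hasP; [exact: h|exact: h'].
Qed.

Lemma hfeq_refl : reflexive hfeq.
Proof.
by elim/hftree_ind_mem => s IH; apply/hfeqP; split => x xs; exists x => //;
  exact: IH.
Qed.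

Lemma hfeq_sym : symmetric hfeq.
Proof.
suff imp t u : hfeq t u -> hfeq u t by move=> t u; apply/idP/idP; exact: imp.
elim/hftree_ind_mem: t u => s IH [s'] /hfeqP[h h']; apply/hfeqP; split.
- by move=> y /h'[x xs xy]; exists x => //; exact: IH.
- by move=> x /[dup] xs /h[y ys xy]; exists y => //; exact: IH.
Qed.

Lemma hfeq_trans : transitive hfeq.
Proof.
move=> u t; elim/hftree_ind_mem: t u => s IH [s'] [s''].
move=> /hfeqP[h1 h1'] /hfeqP[h2 h2']; apply/hfeqP; split.
- move=> x /[dup] xs /h1[y /h2[z zs yz] xy]; exists z => //.
  exact: IH xy yz.
- move=> z /h2'[y /h1'[x xs xy] yz]; exists x => //.
  exact: IH xy yz.
Qed.

Canonical hfeq_equiv := EquivRel hfeq hfeq_refl hfeq_sym hfeq_trans.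

Definition HF : Type := {eq_quot hfeq_equiv}%qT.

(* [None] stands for infinity. *)
Definition least (P : set nat) : option nat :=
  if pselect (exists n, `[< P n >]) is left h then Some (ex_minn h) else None.

Definition le_fin (x : option nat) (n : nat) : bool :=
  if x is Some m then m <= n else false.

Lemma least_leP P n : le_fin (least P) n <-> exists2 m, m <= n & P m.
Proof.
rewrite /least; case: pselect => [h|h] /=.
  case: ex_minnP => m /asboolP Pm min; split; first by exists m.
  by case=> k kn Pk; apply: leq_trans kn; apply: min; apply/asboolP.
by split=> // -[m _ Pm]; case: h; exists m; apply/asboolP.
Qed.

Section graph.
Context {V : Type}.
Implicit Types (E : V -> V -> Prop) (U A B : set V).

Fixpoint walk E (n : nat) (x y : V) : Prop :=
  if n is m.+1 then exists2 z, E x z & walk E m z y else x = y.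

Definition path_metric E x y : option nat := least [set n | walk E n x y].

Definition path_metric_set E A B : option nat :=
  least [set n | exists x y, [/\ A x, B y & walk E n x y]].

Definition graph_power E (r : nat) (x y : V) : Prop :=
  x <> y /\ le_fin (path_metric E x y) r.

(* The induced subgraph on U, kept as a relation on V; its components are the
   sets [component (graph_restrict E U) x] with x in U. *)
Definition graph_restrict E U (x y : V) : Prop := [/\ U x, U y & E x y].

Definition component E (x : V) : set V := [set y | exists n, walk E n x y].

Definition linear_order (lt : V -> V -> Prop) : Prop :=
  [/\ forall x, ~ lt x x,
      forall x y z, lt x y -> lt y z -> lt x z &
      forall x y, [\/ lt x y, x = y | lt y x]].

(* The pieces of an indexed partition may be empty. *)
Definition is_partition (I : Type) (U : I -> set V) : Prop :=
  trivIset [set: I] U /\ \bigcup_i U i = [set: V].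

End graph.

(* A finite relational language extending the language of graphs; the adjacency
   symbol is left implicit. *)
Record language := Language { symbol : finType; arity : symbol -> nat }.

Record sgraph (L : language) (V : Type) := SGraph {
  adj : V -> V -> Prop;
  adj_sym : forall x y, adj x y -> adj y x;
  adj_irr : forall x, ~ adj x x;
  adj_locally_finite : forall x, finite_set [set y | adj x y];
  rels : forall R : symbol L, set ('I_(arity R) -> V) }.

Arguments rels {L V} _ _.

Section induced.
Context {L : language} {V : Type} (G : sgraph L V) (W : set V).

Definition induced_adj (x y : W) : Prop := adj G (val x) (val y).

Lemma induced_adj_sym x y : induced_adj x y -> induced_adj y x.
Proof. exact: adj_sym. Qed.

Lemma induced_adj_irr x : ~ induced_adj x x.
Proof. exact: adj_irr. Qed.

Lemma induced_adj_locally_finite x : finite_set [set y | induced_adj x y].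
Proof.
apply: (@finite_preimage _ _ [set y | adj G (val x) y] (fun y : W => val y)).
  by move=> y z _ _; exact: val_inj.
exact: adj_locally_finite.
Qed.

Definition induced : sgraph L W :=
  @SGraph L W induced_adj induced_adj_sym induced_adj_irr
    induced_adj_locally_finite
    (fun R => [set v : 'I_(arity R) -> W | rels G R (fun i => val (v i))]).

End induced.

Definition sgraph_iso (L : language) (V V' : Type)
    (G : sgraph L V) (G' : sgraph L V') (f : V -> V') : Prop :=
  [/\ bijective f,
      forall x y, adj G x y <-> adj G' (f x) (f y) &
      forall R v, rels G R v <-> rels G' R (f \o v)].

Record coloring_problem := ColoringProblem {
  Gamma : forall (L : language) (V : Type), sgraph L V -> Prop;
  Pi : forall (L : language) (V : Type), sgraph L V -> (V -> HF) -> Prop;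
  Gamma_iso : forall L V V' (G : sgraph L V) (G' : sgraph L V') f,
    sgraph_iso G G' f -> Gamma G -> Gamma G';
  Gamma_components : forall L V (G : sgraph L V),
    Gamma G <-> forall x, Gamma (induced G (component (adj G) x));
  Pi_Gamma : forall L V (G : sgraph L V) c, Pi G c -> Gamma G;
  (* c' is the pushforward along f of c' \o f *)
  Pi_iso : forall L V V' (G : sgraph L V) (G' : sgraph L V') f (c' : V' -> HF),
    sgraph_iso G G' f -> Pi G (c' \o f) -> Pi G' c';
  Pi_components : forall L V (G : sgraph L V) (c : V -> HF),
    Pi G c <-> forall x,
      Pi (induced G (component (adj G) x)) (fun y => c (val y)) }.

Record asi_input (L : language) (s : nat) (V : Type) := AsiInput {
  in_graph : sgraph L V;
  in_finite : finite_set [set: V];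
  in_lt : V -> V -> Prop;
  in_linear : linear_order in_lt;
  in_part : 'I_s.+1 -> set V;
  in_partition : is_partition in_part;
  in_set : set V }.

Definition asi_input_iso (L : language) (s : nat) (V V' : Type)
    (I : asi_input L s V) (J : asi_input L s V') (f : V -> V') : Prop :=
  [/\ sgraph_iso (in_graph I) (in_graph J) f,
      forall x y, in_lt I x y <-> in_lt J (f x) (f y),
      forall i x, in_part I i x <-> in_part J i (f x) &
      forall x, in_set I x <-> in_set J (f x)].

Record asi_algorithm (s : nat) := AsiAlgorithm {
  asi_run : forall (L : language) (V : Type) (I : asi_input L s V),
    in_set I -> HF;
  asi_run_iso : forall (L : language) (V V' : Type)
    (I : asi_input L s V) (J : asi_input L s V') (f : V -> V'),
    asi_input_iso I J f ->
    forall (x : in_set I) (y : in_set J), f (val x) = val y ->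
    asi_run x = asi_run y }.

Section witness.
Context {L : language} {V : Type} (G : sgraph L V) {s : nat} (r : nat)
  (U : 'I_s.+1 -> set V).

Definition piece_graph (i : 'I_s.+1) : V -> V -> Prop :=
  graph_restrict (graph_power (adj G) r) (U i).

Definition asi_witness : Prop :=
  is_partition U /\
  forall i x, U i x -> finite_set (component (piece_graph i) x).

Definition cells : set (set V) :=
  [set C | exists i x, U i x /\ C = component (piece_graph i) x].

Definition cell_graph (C D : set V) : Prop :=
  [/\ cells C, cells D, C <> D & le_fin (path_metric_set (adj G) C D) r].

Definition cell_nbhd (n : nat) (C : set V) : set V :=
  \bigcup_(D in [set D | cells D /\ le_fin (path_metric cell_graph C D) n]) D.

Definition cell_of (x : V) : set V :=
  [set y | exists2 i, U i x & component (piece_graph i) x y].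

Lemma walk_ball_finite n (A : set V) : finite_set A ->
  finite_set [set y | exists2 x, A x & walk (adj G) n x y].
Proof.
elim: n A => [|n IH] A finA.
  by apply: sub_finite_set finA => y [x Ax /= <-].
have finB : finite_set (\bigcup_(x in A) [set y | adj G x y]).
  by apply: bigcup_finite => // x _; exact: adj_locally_finite.
apply: sub_finite_set (IH _ finB) => y [x Ax [z xz zy]].
by exists z => //; exists x.
Qed.

Context (witU : asi_witness).

Lemma cell_ofE i x : U i x -> cell_of x = component (piece_graph i) x.
Proof.
move=> Uix; apply/seteqP; split=> y; last by exists i.
case=> j Ujx; suff -> : j = i by [].
have [[triv _] _] := witU.
by apply: triv => //; exists x.
Qed.

Lemma cells_cell_of x : cells (cell_of x).
Proof.
have [[_ cov] _] := witU.
have [i _ Uix] : (\bigcup_i U i) x by rewrite cov.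
by exists i, x; split => //; exact: cell_ofE.
Qed.

Lemma cell_of_self x : cell_of x x.
Proof.
have [[_ cov] _] := witU.
have [i _ Uix] : (\bigcup_i U i) x by rewrite cov.
by exists i => //; exists 0.
Qed.

Lemma piece_walk_sym i n x y :
  walk (piece_graph i) n x y -> component (piece_graph i) y x.
Proof.
have sym_walk m a b : walk (adj G) m a b -> walk (adj G) m b a.
  have snoc k p q t : walk (adj G) k p q -> adj G q t -> walk (adj G) k.+1 p t.
    elim: k p => [|k IHk] p /=; first by move=> -> qt; exists t.
    by move=> [w pw wq] qt; exists w => //; exact: IHk wq qt.
  elim: m a => [|m IHm] a /=; first by [].
  by move=> [c ac cb]; apply: (snoc m b c a) (IHm _ cb) _; exact: adj_sym.
have sym a b : piece_graph i a b -> piece_graph i b a.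
  case=> Ua Ub [ab /least_leP[m mr w]]; split=> //; split; first exact: nesym.
  by apply/least_leP; exists m => //; exact: sym_walk.
elim: n x => [|n IH] x /=; first by move=> ->; exists 0.
move=> [z xz /IH[m yz]]; exists m.+1.
elim: m {IH} y yz => [|m IHm] y /=.
  by move=> ->; exists x => //; exact: sym.
by move=> [w yw wz]; exists w => //; exact: IHm.
Qed.

Lemma walk_cat (E : V -> V -> Prop) n m x y z :
  walk E n x y -> walk E m y z -> walk E (n + m) x z.
Proof.
elim: n x => [|n IH] x /=; first by move=> ->.
by move=> [w xw wy] yz; exists w => //; exact: IH.
Qed.

Lemma cells_memE C x : cells C -> C x -> C = cell_of x.
Proof.
move=> [i [y [Uiy ->]]] [n yx].
have Uix : U i x.
  elim: n y Uiy yx => [|n IH] y Uiy /=; first by move=> <-.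
  by move=> [z [_ Uiz _]]; exact: IH.
rewrite (cell_ofE Uix); apply/seteqP; split=> z [m h].
  have [k xy] := piece_walk_sym yx.
  by exists (k + m); exact: walk_cat xy h.
by exists (n + m); exact: walk_cat yx h.
Qed.

Lemma cells_finite C : cells C -> finite_set C.
Proof. by move=> [i [x [Uix ->]]]; have [_] := witU; exact. Qed.

Lemma cell_graph_finite C : cells C -> finite_set [set D | cell_graph C D].
Proof.
move=> cC; have finB : finite_set
    (\bigcup_(k in `I_r.+1) [set y | exists2 x, C x & walk (adj G) k x y]).
  apply: bigcup_finite; first exact: finite_II.
  by move=> k _; apply: walk_ball_finite; exact: cells_finite.
apply: sub_finite_set (finite_image cell_of finB).
move=> D [_ cD _ /least_leP[k kr [x [y [Cx Dy w]]]]].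
exists y; last exact/esym/cells_memE.
by exists k => //; exists x.
Qed.

Lemma cell_walk_finite n C : cells C ->
  finite_set [set D | walk cell_graph n C D].
Proof.
elim: n C => [|n IH] C cC.
  by apply: sub_finite_set (finite_set1 C) => D /= ->.
have finB : finite_set (\bigcup_(D in [set D | cell_graph C D])
    [set D' | walk cell_graph n D D']).
  apply: bigcup_finite; first exact: cell_graph_finite.
  by move=> D [_ cD _ _]; exact: IH.
by apply: sub_finite_set finB => D' [D CD DD']; exists D.
Qed.

Lemma cell_nbhd_finite n C : cells C -> finite_set (cell_nbhd n C).
Proof.
move=> cC; apply: bigcup_finite; last by move=> D [cD _]; exact: cells_finite.
have finB : finite_set (\bigcup_(k in `I_n.+1) [set D | walk cell_graph k C D]).
  apply: bigcup_finite; first exact: finite_II.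
  by move=> k _; exact: cell_walk_finite.
apply: sub_finite_set finB => D [_ /least_leP[k kn w]].
by exists k.
Qed.

Lemma cell_nbhd_self n x : cell_nbhd n (cell_of x) x.
Proof.
exists (cell_of x); last exact: cell_of_self.
split; first exact: cells_cell_of.
by apply/least_leP; exists 0.
Qed.

Context (n : nat) (lt : V -> V -> Prop) (linlt : linear_order lt).

Section local_input.
Context (C : set V) (cC : cells C).
Let W := cell_nbhd n C.

Lemma local_finite : finite_set [set: W].
Proof.
have := @finite_preimage _ _ W (fun y : W => val y)
  (fun y z _ _ e => val_inj e) (cell_nbhd_finite n cC).
by apply: sub_finite_set => y _; exact: (set_mem (valP y)).
Qed.

Lemma local_linear : linear_order (fun x y : W => lt (val x) (val y)).
Proof.
case: linlt => irr tr tot; split=> [x|x y z|x y]; [exact: irr|exact: tr|].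
by case: (tot (val x) (val y)); [constructor 1|move/val_inj; constructor 2|
  constructor 3].
Qed.

Lemma local_partition : is_partition (fun i => [set x : W | U i (val x)]).
Proof.
have [[triv cov] _] := witU; split.
  by move=> i j _ _ [x [Ui Uj]]; apply: triv => //; exists (val x).
apply/seteqP; split=> // x _.
have [i _ Ui] : (\bigcup_i U i) (val x) by rewrite cov.
by exists i.
Qed.

Definition local_input : asi_input L s W :=
  AsiInput (induced G W) local_finite local_linear local_partition
    [set x : W | C (val x)].

End local_input.

Definition cell_point (x : V) : in_set (local_input (cells_cell_of x)) :=
  exist _ (exist _ x (mem_set (@cell_nbhd_self n x)))
    (mem_set (cell_of_self x)).

Definition asi_coloring (A : asi_algorithm s) (x : V) : HF :=
  asi_run A (cell_point x).

End witness.

Definition ASI (s : nat) (P : coloring_problem) : Prop :=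
  exists (A : asi_algorithm s) (n r : nat),
  forall (L : language) (V : Type) (G : sgraph L V), Gamma P G ->
  forall (lt : V -> V -> Prop) (linlt : linear_order lt)
    (U : 'I_s.+1 -> set V) (witU : asi_witness G r U),
  Pi P G (asi_coloring witU n linlt A).

Definition polish (R : realType) (T : topologicalType) : Prop :=
  (exists2 D : set T, countable D & dense D) /\
  exists d : T -> T -> R,
  [/\ [/\ forall x y, d x y = 0%R <-> x = y,
          forall x y, d x y = d y x &
          forall x y z, (d x z <= d x y + d y z)%R],
      forall A : set T, open A <->
        forall x, A x -> exists2 e : R, (0 < e)%R &
          forall y, (d x y < e)%R -> A y &
      forall u : nat -> T,
        (forall e : R, (0 < e)%R -> exists N, forall m n,
           N <= m -> N <= n -> (d (u m) (u n) < e)%R) ->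
        exists l, forall e : R, (0 < e)%R -> exists N, forall n,
          N <= n -> (d (u n) l < e)%R].

Definition borel (T : topologicalType) : set (set T) :=
  <<s [set A : set T | open A] >>.

Definition borel_sgraph (L : language) (T : topologicalType)
    (G : sgraph L T) : Prop :=
  borel [set p : T * T | adj G p.1 p.2] /\
  forall R : symbol L, @borel {ptws 'I_(arity R) -> T} (rels G R).

(* HF is discrete, so each A : set HF is open. *)
Definition borel_coloring (T : topologicalType) (c : T -> HF) : Prop :=
  forall A : set HF, borel (c @^-1` A).

Definition asi_number (L : language) (T : topologicalType) (G : sgraph L T) :
    option nat :=
  least [set s | forall r, exists U : 'I_s.+1 -> set T,
    asi_witness G r U /\ forall i, borel (U i)].

Definition asi (R : realType) (s : nat) (P : coloring_problem) : Prop :=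
  forall (L : language) (T : topologicalType) (G : sgraph L T),
  polish R T -> borel_sgraph G -> Gamma P G -> le_fin (asi_number G) s ->
  exists2 c : T -> HF, borel_coloring c & Pi P G c.

(* Main.v *)
Require Import Defs.
From mathcomp Require Import all_boot all_order all_algebra.
From mathcomp Require Import all_classical all_reals all_analysis.
From mathcomp Require Import lra.

Set Implicit Arguments.
Unset Strict Implicit.
Unset Printing Implicit Defensive.

Import Order.TTheory GRing.Theory Num.Theory.
Local Open Scope classical_set_scope.

(** Code the vertex space [T] injectively by points of Baire space, the digits
    recording membership in countably many balls: the lexicographic order of
    codes is a Borel linear order on [T].  A locally finite Borel graph is
    covered by countably many Borel functions (Lusin-Novikov), so everything
    reachable from [x] is the value at [x] of one of countably many words in
    these functions, and a relation between the values of two words that is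
    built from Borel ones by quantifying over reachable points is Borel in [x].
    Hence so is the statement that a given finite list of words enumerates the
    neighbourhood fed to the algorithm at [x].  Once the list is fixed, finitely
    many Borel conditions determine this input up to isomorphism, and so
    determine the color of [x].

    For Lusin-Novikov with finite sections: an analytic relation [A] that no
    countable family of Borel functions covers contains an uncoverable part
    whose second coordinates extend a string [v] and whose sections also meet
    an incompatible string [u]; otherwise [A] minus a countable family of graphs
    is single-valued, hence covered by Lusin separation of the digits.
    Iterating and fusing yields a point with an infinite section. *)

(** * Closure of generated sigma-algebras under logical connectives and countable quantifiers *)

Section sigma_generated.
Context {X : Type} (G : set (set X)).
Implicit Types P Q : X -> Prop.

Lemma sgen_not P : <<s G >> [set x | P x] -> <<s G >> [set x | ~ P x].
Proof. by rewrite -[X in _ -> _ X]setTD; exact: sigma_algebraCD. Qed.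

Lemma sgen_ex (I : countType) (P : I -> X -> Prop) :
  (forall i, <<s G >> [set x | P i x]) -> <<s G >> [set x | exists i, P i x].
Proof.
move=> GP; pose F n : set X := if unpickle n is Some i then P i else set0.
rewrite (_ : [set x | _] = \bigcup_n F n).
  apply: sigma_algebra_bigcup => n; rewrite /F.
  by case: unpickle => [i|]; [exact: GP|exact: sigma_algebra0].
apply/seteqP; split=> [x [i Pix]|x [n _]].
  by exists (pickle i) => //; rewrite /F pickleK.
by rewrite /F; case: unpickle => // i; exists i.
Qed.

Lemma sgen_iff P Q : (forall x, P x <-> Q x) -> <<s G >> [set x | P x] ->
  <<s G >> [set x | Q x].
Proof. by move=> PQ; rewrite (_ : [set x | P x] = [set x | Q x])//;
  apply/seteqP; split=> x /PQ. Qed.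

Lemma sgen_all (I : countType) (P : I -> X -> Prop) :
  (forall i, <<s G >> [set x | P i x]) -> <<s G >> [set x | forall i, P i x].
Proof.
move=> GP; apply: (@sgen_iff (fun x => ~ exists i, ~ P i x)) => [x|].
  split=> [h i|h [i]]; last exact.
  by apply: contrapT => nP; apply: h; exists i.
apply: sgen_not; apply: sgen_ex => i; apply: sgen_not; exact: GP.
Qed.

Lemma sgen_cst (p : Prop) : <<s G >> [set x | p].
Proof.
have [hp|hp] := pselect p.
  apply: (@sgen_iff (fun=> ~ False)) => [x|]; first by split=> // _ [].
  by apply: sgen_not; exact: sigma_algebra0.
by apply: (@sgen_iff (fun=> False)) => [x|]; [by split|exact: sigma_algebra0].
Qed.

Lemma sgen_or P Q : <<s G >> [set x | P x] -> <<s G >> [set x | Q x] ->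
  <<s G >> [set x | P x \/ Q x].
Proof.
move=> GP GQ.
apply: (@sgen_iff (fun x => exists b : bool, if b then P x else Q x)).
  move=> x; split=> [[[] h]|[h|h]]; [by left|by right| |].
    by exists true.
  by exists false.
by apply: (@sgen_ex _ (fun (b : bool) x => if b then P x else Q x)) => -[].
Qed.

Lemma sgen_and P Q : <<s G >> [set x | P x] -> <<s G >> [set x | Q x] ->
  <<s G >> [set x | P x /\ Q x].
Proof.
move=> GP GQ; apply: (@sgen_iff (fun x => ~ (~ P x \/ ~ Q x))).
  by move=> x; rewrite not_orE !notK.
by apply: sgen_not; apply: sgen_or; apply: sgen_not.
Qed.

Lemma sgen_imp P Q : <<s G >> [set x | P x] -> <<s G >> [set x | Q x] ->
  <<s G >> [set x | P x -> Q x].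
Proof.
move=> GP GQ; apply: (@sgen_iff (fun x => ~ P x \/ Q x)).
  by move=> x; rewrite implyE.
by apply: sgen_or => //; apply: sgen_not.
Qed.

Lemma sgen_when (p : Prop) Q : (p -> <<s G >> [set x | Q x]) ->
  <<s G >> [set x | p /\ Q x].
Proof.
move=> GQ; have [hp|hp] := pselect p.
  by apply: sgen_and; [exact: sgen_cst|exact: GQ].
by apply: (@sgen_iff (fun=> False)) => [x|]; [split=> // -[]|exact: sgen_cst].
Qed.

End sigma_generated.

(** The sets whose preimage lies in [<<s G >>] form a sigma-algebra, so it suffices to test
    generators. *)
Lemma sgen_preimage (X Y : Type) (G : set (set X)) (H : set (set Y)) (f : X ->
  Y) :
  (forall A, H A -> <<s G >> (f @^-1` A)) ->
  forall A, <<s H >> A -> <<s G >> (f @^-1` A).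
Proof.
move=> GH A HA.
have SA : sigma_algebra setT [set B : set Y | <<s G >> (f @^-1` B)].
  split.
  - by rewrite /= preimage_set0; exact: sigma_algebra0.
  - by move=> B GB; rewrite setTD; exact: sgen_not.
  - by move=> F GF; rewrite /= preimage_bigcup; exact: sigma_algebra_bigcup.
by apply: (HA _ (conj SA _)) => B /GH.
Qed.

(** * Analytic sets in Baire space *)

Definition baire := nat -> nat.

Definition agree (V : Type) (n : nat) (x y : nat -> V) :=
  forall k, k < n -> x k = y k.

Lemma agreeW V m n (x y : nat -> V) : m <= n -> agree n x y -> agree m x y.
Proof. by move=> mn h k /leq_trans/(_ mn)/h. Qed.

Lemma agree_sym V n (x y : nat -> V) : agree n x y -> agree n y x.
Proof. by move=> h k /h. Qed.

Lemma agree_trans V n (y x z : nat -> V) :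
  agree n x y -> agree n y z -> agree n x z.
Proof. by move=> h h' k kn; rewrite h// h'. Qed.

(* The conclusion is of use when [P m l x] depends only on [x] below [l]. *)
Lemma fusion (V : Type) (P : nat -> nat -> (nat -> V) -> Prop) :
  (exists l x, P 0 l x) ->
  (forall m l x, P m l x ->
    exists l' x', [/\ l < l', agree l x' x & P m.+1 l' x']) ->
  exists x, forall m, exists l x', [/\ m <= l, agree l x' x & P m l x'].
Proof.
move=> [l0 [x0 P0]] step.
(* Bundling a stage with a proof of [P] makes the successor step total, so that it can be chosen
   once and iterated. *)
pose S := {q : nat * (nat * (nat -> V)) | P q.1 q.2.1 q.2.2}.
pose R (a b : S) := [/\ (sval b).1 = (sval a).1.+1,
  (sval a).2.1 < (sval b).2.1 & agree (sval a).2.1 (sval b).2.2 (sval a).2.2].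
have /choice[nxt nxtP] : forall a, exists b, R a b.
  move=> [[m [l x]] /= h]; have [l' [x' [ll' ag h']]] := step _ _ _ h.
  by exists (exist _ (m.+1, (l', x')) h').
pose a m := iter m nxt (exist _ (0, (l0, x0)) P0).
have aE m : (sval (a m)).1 = m.
  by elim: m => // m IH; rewrite /a iterS (let: And3 e _ _ :=
    nxtP _ in e) -/(a m) IH.
pose l m := (sval (a m)).2.1; pose x m := (sval (a m)).2.2.
have lS m : l m < l m.+1 by case: (nxtP (a m)).
have xS m : agree (l m) (x m.+1) (x m) by case: (nxtP (a m)).
have lm m : m <= l m by elim: m => // m IH; exact: leq_ltn_trans (lS m).
have llD m k : l m <= l (m + k).
  by elim: k => [|k IH]; rewrite ?addn0// addnS; apply: leq_trans IH (ltnW _).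
have xD m k : agree (l m) (x (m + k)) (x m).
  elim: k => [|k IH]; first by rewrite addn0.
  by rewrite addnS; apply: agree_trans IH; apply: agreeW (xS _); exact: llD.
(* Digit [k] is read off stage [k.+1], whose prefix length exceeds [k]; it is therefore already
   final. *)
exists (fun k => x k.+1 k) => m; exists (l m), (x m); split=> //; last first.
  by have := svalP (a m); rewrite aE.
move=> k klm; case: (leqP m k.+1) => h.
  by rewrite -(subnKC h) xD.
by rewrite -{1}(subnKC (ltnW h)) xD//; exact: lm.
Qed.

Definition npair (a b : nat) : nat := pickle (a, b).
(* [nunpair] only inverts [npair] on its range: [bpair (bfst p) (bsnd p)] need
   not be [p]. *)
Definition nunpair (c : nat) : nat * nat := odflt (0, 0) (unpickle c).

Lemma npairK a b : nunpair (npair a b) = (a, b).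
Proof. by rewrite /nunpair /npair pickleK. Qed.

Definition bpair (x y : baire) : baire := fun n => npair (x n) (y n).
Definition bfst (p : baire) : baire := fun n => (nunpair (p n)).1.
Definition bsnd (p : baire) : baire := fun n => (nunpair (p n)).2.

Lemma bfst_pair x y : bfst (bpair x y) = x.
Proof. by apply/funext => n; rewrite /bfst npairK. Qed.

Lemma bsnd_pair x y : bsnd (bpair x y) = y.
Proof. by apply/funext => n; rewrite /bsnd npairK. Qed.

(** These are the 1-Lipschitz maps for the usual ultrametric on Baire space. *)
Definition nonexpansive (f : baire -> baire) :=
  forall n x y, agree n x y -> agree n (f x) (f y).

Lemma nonexpansive_fst : nonexpansive bfst.
Proof. by move=> n x y h k /h; rewrite /bfst => ->. Qed.

Lemma nonexpansive_snd : nonexpansive bsnd.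
Proof. by move=> n x y h k /h; rewrite /bsnd => ->. Qed.

Lemma nonexpansive_comp f g :
  nonexpansive f -> nonexpansive g -> nonexpansive (f \o g).
Proof. by move=> hf hg n x y /hg/hf. Qed.

Lemma nonexpansive_pair f g : nonexpansive f -> nonexpansive g ->
  nonexpansive (fun x => bpair (f x) (g x)).
Proof.
by move=> hf hg n x y h k kn;
  rewrite /bpair (hf _ _ _ h k kn) (hg _ _ _ h k kn).
Qed.

(* [C] is closed in the product topology, stated through finite prefixes. *)
Definition closed2 (C : baire -> baire -> Prop) :=
  forall x z, (forall n, exists x' z',
    [/\ agree n x' x, agree n z' z & C x' z']) -> C x z.

Definition analytic (A : set baire) :=
  exists2 C, closed2 C & forall x, A x <-> exists z, C x z.

Lemma analytic_iff (A B : set baire) : (forall x, A x <-> B x) ->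
  analytic A -> analytic B.
Proof. by move=> AB [C cC AzC]; exists C => // x; rewrite -AB. Qed.

Lemma analytic_closed (A : set baire) :
  (forall x, (forall n, exists2 y, agree n y x & A y) -> A x) -> analytic A.
Proof.
move=> cA; exists (fun x _ => A x) => [x z h|x].
  by apply: cA => n; have [y [_ [ag _ Ay]]] := h n; exists y.
by split=> [Ax|[]//]; exists x.
Qed.

Lemma analytic_digit n (Q : nat -> Prop) : analytic [set x | Q (x n)].
Proof.
by apply: analytic_closed => x /(_ n.+1)[y h]; rewrite /= h.
Qed.

Lemma analytic_agree l (p : baire) : analytic [set x | agree l x p].
Proof.
apply: analytic_closed => x h k kl; have [y yx yp] := h l.
by rewrite -yx// yp.
Qed.

(** The witness stores the index of the union in digit 0 and the old witness, shifted, after it.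
    Every nonempty prefix fixes the index, which keeps the relation closed. *)
Lemma analytic_ex (A : nat -> set baire) : (forall k, analytic (A k)) ->
  analytic [set x | exists k, A k x].
Proof.
move=> anA; have /choice[C CP] : forall k, exists C, closed2 C /\
    forall x, A k x <-> exists z, C x z.
  by move=> k; have [C] := anA k; exists C.
exists (fun x z => C (z 0) x (fun n => z n.+1)).
  move=> x z h; apply: (proj1 (CP (z 0))) => n.
  have [x' [z' [xx' zz' cz]]] := h n.+1; exists x', (fun n => z' n.+1).
  split; [exact: agreeW xx'|by move=> k kn; exact: zz'|].
  by rewrite -zz'.
move=> x; split=> [[k /(proj2 (CP k))[z Cz]]|[z Cz]].
  by exists (fun n => if n is m.+1 then z m else k).
by exists (z 0); apply/(proj2 (CP _)); eexists; exact: Cz.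
Qed.

(** One witness interleaves a witness for each index, row [k] sitting at the positions
    [npair k n]. *)
Lemma analytic_all (A : nat -> set baire) : (forall k, analytic (A k)) ->
  analytic [set x | forall k, A k x].
Proof.
move=> anA; have /choice[C CP] : forall k, exists C, closed2 C /\
    forall x, A k x <-> exists z, C x z.
  by move=> k; have [C] := anA k; exists C.
exists (fun x z => forall k, C k x (fun n => z (npair k n))).
  move=> x z h k; apply: (proj1 (CP k)) => n.
  (* A prefix of length [m] contains the first [n] entries of row [k]. *)
  pose m := maxn n (\max_(i < n) (npair k i).+1).
  have [x' [z' [xx' zz' cz]]] := h m; exists x', (fun n => z' (npair k n)).
  split=> //; first by apply: agreeW xx'; exact: leq_maxl.
  move=> i lin; apply: zz'; rewrite leq_max; apply/orP; right.
  exact: (@leq_bigmax _ (fun i : 'I_n => (npair k i).+1) (Ordinal lin)).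
move=> x; split=> [h|[z Cz] k]; last first.
  by apply/(proj2 (CP k)); eexists; exact: Cz.
have /choice[z zP] : forall k, exists z, C k x z by move=> k;
  apply/(proj2 (CP k)).
exists (fun m => z (nunpair m).1 (nunpair m).2) => k.
by rewrite (_ : (fun n => _) = z k)//; apply/funext => n; rewrite npairK.
Qed.

Lemma analytic_preimage f (A : set baire) : nonexpansive f -> analytic A ->
  analytic [set x | A (f x)].
Proof.
move=> nef [C cC AzC]; exists (fun x => C (f x)) => [x z h|x]; last exact: AzC.
apply: cC => n; have [x' [z' [xx' zz' cz]]] := h n.
by exists (f x'), z'; split=> //; exact: nef.
Qed.

Lemma analytic_and (A B : set baire) : analytic A -> analytic B ->
  analytic [set x | A x /\ B x].
Proof.
move=> anA anB; apply: (@analytic_iff [set x | forall k,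
  (if k is 0 then A else B) x]).
  by move=> x; split=> [h|[hA hB] []//]; split; [exact: (h 0)|exact: (h 1)].
by apply: analytic_all => -[].
Qed.

(** The projected coordinate is absorbed into the witness. *)
Lemma analytic_proj (A : set baire) : analytic A ->
  analytic [set x | exists y, A (bpair x y)].
Proof.
move=> [C cC AzC]; exists (fun x z => C (bpair x (bfst z)) (bsnd z)).
  move=> x z h; apply: cC => n; have [x' [z' [xx' zz' cz]]] := h n.
  exists (bpair x' (bfst z')), (bsnd z'); split=> //.
    move=> k kn; rewrite /bpair (xx' k kn); congr npair.
    exact: nonexpansive_fst zz' k kn.
  exact: nonexpansive_snd.
move=> x; split=> [[y /AzC[z Cz]]|[z Cz]].
  by exists (bpair y z); rewrite bfst_pair bsnd_pair.
by exists (bfst z); apply/AzC; exists (bsnd z).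
Qed.

(** * Borel subsets of Baire space and Lusin separation *)

Definition digit_sets : set (set baire) :=
  [set A | exists n i, A = [set x | x n = i]].

Notation bor := (<<s digit_sets >>).

Lemma bor_digit n i : bor [set x | x n = i].
Proof. by apply: sub_sigma_algebra; exists n, i. Qed.

(** The sets that are analytic together with their complement form a sigma-algebra containing the
    digit sets. *)
Lemma bor_analytic (A : set baire) : bor A -> analytic A.
Proof.
move=> bA; have SA : sigma_algebra setT [set B | analytic B /\ analytic (~` B)].
  split.
  - split; first exact: (analytic_digit 0 (fun=> False)).
    apply: analytic_iff (analytic_digit 0 (fun=> True)) => x.
    by rewrite setC0.
  - by move=> B [aB aC]; rewrite setTD /= setCK.
  - move=> F aF; split.
      apply: analytic_iff (analytic_ex (fun k => (aF k).1)) => x.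
      by split=> [[k]|[k _]]; exists k.
    rewrite setC_bigcup; apply: analytic_iff (analytic_all (fun k =>
      (aF k).2)) => x.
    by split=> [h k _|h k]; exact: h.
apply: (proj1 (bA _ (conj SA _))) => _ [n [i ->]]; split.
  exact: (analytic_digit n (fun j => j = i)).
exact: (analytic_digit n (fun j => j <> i)).
Qed.

Definition separated (A B : set baire) :=
  exists2 S, bor S & A `<=` S /\ forall x, B x -> ~ S x.

(** If [S (i, j)] separates [F i] from [H j], then the union over [i] of the intersections over [j]
    separates the unions. *)
Lemma separated_bigcup (I J : countType) (F : I -> set baire) (H : J ->
  set baire)
    (A B : set baire) :
  (forall x, A x -> exists i, F i x) -> (forall x, B x -> exists j, H j x) ->
  (forall i j, separated (F i) (H j)) -> separated A B.
Proof.
move=> AF BH sFH.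
have /choice[S SP] : forall ij : I * J, exists S, bor S /\ (F ij.1 `<=` S /\
    forall x, H ij.2 x -> ~ S x).
  by move=> [i j]; have [S bS hS] := sFH i j; exists S.
exists [set x | exists i, forall j, S (i, j) x].
  by apply: sgen_ex => i; apply: sgen_all => j; have [] := SP (i, j).
split=> [x /AF[i Fx]|x /BH[j Hx] [i /(_ j)]].
  by exists i => j; have [_ [h _]] := SP (i, j); exact: h.
by have [_ [_ h]] := SP (i, j); exact: h.
Qed.

(** If [A] and [B] are inseparable, then prefixes of points and witnesses can be lengthened digit by
    digit so that the corresponding pieces stay inseparable. The fused limit contradicts either
    disjointness or inseparability. *)
Lemma lusin_separation (A B : set baire) : analytic A -> analytic B ->
  (forall x, A x -> ~ B x) -> separated A B.
Proof.
move=> [C cC AzC] [D cD BzD] dAB; apply: contrapT => nsep.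
pose piece (E : baire -> baire -> Prop) l (p q : baire) : set baire :=
  [set x | agree l x p /\ exists2 z, agree l z q & E x z].
(* One entry holds a digit of a point of [A] and of its witness, then the same for [B]. *)
pose V := (nat * nat * (nat * nat))%type.
pose P (m l : nat) (s : nat -> V) := l = m /\
  ~ separated (piece C l (fun k => (s k).1.1) (fun k => (s k).1.2))
              (piece D l (fun k => (s k).2.1) (fun k => (s k).2.2)).
have [||s sP] := @fusion V P.
- exists 0, (fun=> (0, 0, (0, 0))); split=> // -[S bS [h1 h2]]; apply: nsep;
    exists S => //; split.
    by move=> x /AzC[z Cz]; apply: h1; split=> //; exists z.
  by move=> x /BzD[z Cz]; apply: h2; split=> //; exists z.
- move=> m l s [-> {l} ns]; pose s' (v : V) k := if k == m then v else s k.
  suff [v nv] : exists v, ~ separated (piece C m.+1 (fun k =>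
    (s' v k).1.1) (fun k => (s' v k).1.2))
              (piece D m.+1 (fun k => (s' v k).2.1) (fun k => (s' v k).2.2)).
    by exists m.+1, (s' v); split=> // k km; rewrite /s' ltn_eqF.
  apply: contrapT => nex; apply: ns.
  pose upd (p : baire) i k := if k == m then i else p k.
  have updP p i x : agree m x p -> x m = i -> agree m.+1 x (upd p i).
    move=> h xi k; rewrite ltnS leq_eqVlt /upd => /orP[/eqP->|km];
      first by rewrite eqxx.
    by rewrite ltn_eqF// h.
  apply: (@separated_bigcup (nat * nat)%type (nat * nat)%type
    (fun ij => piece C m.+1 (upd (fun k => (s k).1.1) ij.1) (upd (fun k =>
      (s k).1.2) ij.2))
    (fun ij => piece D m.+1 (upd (fun k => (s k).2.1) ij.1) (upd (fun k =>
      (s k).2.2) ij.2))).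
  + by move=> x [xs [z zs Cz]]; exists (x m, z m); split;
      [exact: updP|exists z => //; exact: updP].
  + by move=> x [xs [z zs Cz]]; exists (x m, z m); split;
      [exact: updP|exists z => //; exact: updP].
  move=> [i j] [i' j'] /=; apply: contrapT => ns; apply: nex;
    exists ((i, j), (i', j')).
  suff e (g : V -> nat) : (fun k => g (s' (i, j, (i', j')) k)) = upd (fun k =>
    g (s k)) (g (i, j, (i', j'))).
    by rewrite (e (fun v => v.1.1)) (e (fun v => v.1.2)) (e (fun v =>
      v.2.1)) (e (fun v => v.2.2)).
  by apply/funext => k; rewrite /s' /upd; case: eqP.
pose a k := (s k).1.1; pose b k := (s k).2.1.
have nonempty n : exists x z y w, [/\ agree n x a, agree n z (fun k =>
  (s k).1.2),
    agree n y b & agree n w (fun k => (s k).2.2)] /\ C x z /\ D y w.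
  have [l [t [_ ts [le ns]]]] := sP n; subst l.
  apply: contrapT => ne; apply: ns.
  (* An empty piece would be separated from the other one by [setT] or by [set0]. *)
  have [[x [xt [z zt Cz]]]|h] := pselect (exists x, piece C n (fun k =>
    (t k).1.1) (fun k => (t k).1.2) x).
    exists setT; first exact: sgen_cst.
    split=> // y [yt [w wt Dw]] _; apply: ne; exists x, z, y, w; split=> //.
    by split=> k kn; rewrite ?xt ?zt ?yt ?wt// /a /b ts.
  exists set0; first exact: sigma_algebra0.
  by split=> [x hx|x _ []]; case: h; exists x.
(* If the limits coincide, closedness puts the common point in both sets. If they differ at digit
   [n], one digit set separates the pieces of length [n.+1]. *)
have [e|/eqP ne] := eqVneq a b.
  have Ca : C a (fun k => (s k).1.2).
    by apply: cC => n; have [x [z [_ [_ [[? ? _ _] [? _]]]]]] := nonempty n;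
      exists x, z.
  have Db : D b (fun k => (s k).2.2).
    by apply: cD => n; have [_ [_ [x [z [[_ _ ? ?] [_ ?]]]]]] := nonempty n;
      exists x, z.
  apply: (dAB a); first by apply/AzC; eexists; exact: Ca.
  by rewrite e; apply/BzD; eexists; exact: Db.
have [n abn] : exists n, a n <> b n.
  by apply: contrapT => h; apply: ne; apply/funext => n; apply: contrapT => ?;
    apply: h; exists n.
have [l [t [_ ts [le ns]]]] := sP n.+1; subst l.
apply: ns; exists [set x | x n = a n]; first exact: bor_digit.
split=> [x [h _]|y [h _]]; rewrite /= h// ts//.
by move=> h'; exact/abn.
Qed.

(** * Analytic relations with finite sections *)

Definition analytic2 (A : baire -> baire -> Prop) :=
  analytic [set p | A (bfst p) (bsnd p)].

Definition bor_map (X : Type) (G : set (set X)) (f : X -> baire) :=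
  forall n i, <<s G >> [set x | f x n = i].

Lemma bor_map_preimage X (G : set (set X)) f A : bor_map G f -> bor A ->
  <<s G >> [set x | A (f x)].
Proof.
by move=> bf; apply: (@sgen_preimage _ _ G digit_sets f) => _ [n [i ->]];
  exact: bf.
Qed.

Lemma bor_map_digit X (G : set (set X)) f n (Q : nat -> Prop) :
  bor_map G f -> <<s G >> [set x | Q (f x n)].
Proof.
move=> bf; apply: (@sgen_iff _ _ (fun x => exists i, Q i /\ f x n = i)).
  by move=> x; split=> [[i [Qi ->]]|Qx] //; exists (f x n).
by apply: sgen_ex => i; apply: sgen_when => _; exact: bf.
Qed.

Lemma bor_map_digit2 X (G : set (set X)) f g n (Q : nat -> nat -> Prop) :
  bor_map G f -> bor_map G g -> <<s G >> [set x | Q (f x n) (g x n)].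
Proof.
move=> bf bg; apply: (@sgen_iff _ _ (fun x => exists i, f x n = i /\
  Q i (g x n))).
  by move=> x; split=> [[i [-> Qi]]|Qx] //; exists (f x n).
by apply: sgen_ex => i; apply: sgen_and;
  [exact: bf|exact: (bor_map_digit _ (Q i))].
Qed.

Lemma bor_map_pair X (G : set (set X)) f g : bor_map G f -> bor_map G g ->
  bor_map G (fun x => bpair (f x) (g x)).
Proof.
by move=> bf bg n i; exact: (bor_map_digit2 n (fun a b => npair a b = i) bf bg).
Qed.

Lemma bor_map_id : bor_map digit_sets id.
Proof. by move=> n i; exact: bor_digit. Qed.

Lemma bor_map_fst : bor_map digit_sets bfst.
Proof. by move=> n i; exact: (bor_map_digit n (fun c =>
  (nunpair c).1 = i) bor_map_id). Qed.

Lemma bor_map_snd : bor_map digit_sets bsnd.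
Proof. by move=> n i; exact: (bor_map_digit n (fun c =>
  (nunpair c).2 = i) bor_map_id). Qed.

Lemma bor_map_comp X (G : set (set X)) f g : bor_map digit_sets g ->
  bor_map G f ->
  bor_map G (g \o f).
Proof. by move=> bg bf n i; apply: (bor_map_preimage bf (bg n i)). Qed.

Definition coverable (A : baire -> baire -> Prop) :=
  exists2 f : nat -> baire -> baire, forall k, bor_map digit_sets (f k) &
    forall x y, A x y -> exists k, y = f k x.

Lemma coverable_sub A B : (forall x y, A x y -> B x y) ->
  coverable B -> coverable A.
Proof. by move=> AB [f bf fP]; exists f => // x y /AB/fP. Qed.

Lemma coverable_bigcup (I : countType) (F : I -> baire -> baire -> Prop) A :
  (forall x y, A x y -> exists i, F i x y) -> (forall i, coverable (F i)) ->
  coverable A.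
Proof.
move=> AF cF.
have /choice[f fP] : forall i, exists f : nat -> baire -> baire,
    (forall k, bor_map digit_sets (f k)) /\ forall x y, F i x y -> exists k,
      y = f k x.
  by move=> i; have [f] := cF i; exists f.
(* Numbers that code no pair are filled with the identity. *)
exists (fun n x => if (unpickle n :
  option (I * nat)) is Some ik then f ik.1 ik.2 x else x).
  move=> n; case: unpickle => [[i k]|]; last exact: bor_map_id.
  exact: (fP i).1.
move=> x y /AF[i /((fP i).2)[k ->]].
by exists (pickle (i, k)); rewrite pickleK.
Qed.

Lemma coverable_when (p : Prop) A : (p -> coverable A) ->
  coverable (fun x y => p /\ A x y).
Proof.
move=> cA; have [hp|hp] := pselect p.
  by apply: coverable_sub (cA hp) => x y [].
by exists (fun=> id) => [_|x y []//]; exact: bor_map_id.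
Qed.

(** As [A] is single-valued, the analytic sets [E n i] of points whose value has digit [n] equal to
    [i] are disjoint for distinct [i]. Separating them by Borel sets allows the digits of the value
    to be read off in a Borel way. *)
Lemma coverable_functional A : analytic2 A ->
  (forall x y y', A x y -> A x y' -> y = y') -> coverable A.
Proof.
move=> anA funA; pose E n i : set baire := [set x | exists y, A x y /\ y n = i].
have anE n i : analytic (E n i).
  have := analytic_proj (analytic_and anA
    (analytic_preimage nonexpansive_snd (analytic_digit n (fun j => j = i)))).
  apply: analytic_iff => x.
  by split=> -[y h]; exists y; move: h; rewrite /= !bfst_pair !bsnd_pair.
have /choice[S SP] : forall nij : nat * nat * nat, exists S, bor S /\
   (nij.1.2 <> nij.2 -> E nij.1.1 nij.1.2 `<=` S /\
     forall x, E nij.1.1 nij.2 x -> ~ S x).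
  move=> [[n i] j] /=; have [->|/eqP ij] := eqVneq i j.
    by exists set0; split=> //; exact: sigma_algebra0.
  have [|S bS hS] := lusin_separation (anE n i) (anE n j); last by exists S.
  move=> x [y [Axy yi]] [y' [/(funA _ _ _ Axy)<- yj]].
  by apply: ij; rewrite -yi.
pose D n i x := forall j, i <> j -> S (n, i, j) x.
have bD n i : bor [set x | D n i x].
  apply: sgen_all => j; apply: sgen_imp; first exact: sgen_cst.
  exact: (SP (n, i, j)).1.
have ED n i x : E n i x -> D n i x.
  by move=> Ex j ij; have [h _] := (SP (n, i, j)).2 ij; exact: h.
have EnD n i j x : i <> j -> E n i x -> ~ D n j x.
  move=> ij Ex /(_ i (nesym ij)).
  by have [_ h] := (SP (n, j, i)).2 (nesym ij); exact: h.
(* [D n i] contains [E n i] and misses every other [E n j]; removing overlaps keeps both properties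
   and makes the index unique. *)
pose D' n i x := D n i x /\ forall j, i <> j -> ~ D n j x.
have bD' n i : bor [set x | D' n i x].
  apply: sgen_and; first exact: bD.
  apply: sgen_all => j; apply: sgen_imp; first exact: sgen_cst.
  by apply: sgen_not; exact: bD.
(* Where no index qualifies, the digit defaults to 0, which is again a Borel case. *)
have /choice[g gP] : forall xn : baire * nat, exists i,
    D' xn.2 i xn.1 \/ i = 0 /\ forall j, ~ D' xn.2 j xn.1.
  move=> [x n] /=; have [[i Di]|h] := pselect (exists i, D' n i x).
    by exists i; left.
  by exists 0; right; split=> // j Dj; apply: h; exists j.
have D'u n i j x : D' n i x -> D' n j x -> i = j.
  by move=> [Di _] [_ h]; apply: contrapT => ij; exact: (h i (nesym ij)).
exists (fun _ x n => g (x, n)) => [_ n i|x y Axy].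
  apply: (@sgen_iff _ _ (fun x => D' n i x \/ (i = 0 /\ forall j, ~ D' n j x))).
    move=> x; split; last by move=> <-; exact: gP.
    case: (gP (x, n)) => /= [Dg [Di|[_ h]]|[-> h] [Di|[]//]].
    - exact: D'u Dg Di.
    - by case: (h _ Dg).
    - by case: (h _ Di).
  apply: sgen_or; first exact: bD'.
  by apply: sgen_and; [exact: sgen_cst|apply: sgen_all => j; apply: sgen_not;
    exact: bD'].
exists 0; apply/funext => n.
have Dy : D' n (y n) x.
  have Ey : E n (y n) x by exists y.
  by split=> [|j]; [exact: ED|move=> ij; exact: EnD Ey].
by case: (gP (x, n)) => [/(D'u _ _ _ _ Dy)//|[_ /(_ _ Dy)]].
Qed.

(** There are only countably many pairs of strings. If every corresponding part were coverable,
    deleting the covering graphs would leave a single-valued analytic relation, since two values of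
    one point differ on some prefix of length at least [l]; then [A] would be coverable. *)
Lemma not_coverable_split A l : analytic2 A -> ~ coverable A ->
  exists n u v, [/\ l <= n, ~ agree n u v &
    ~ coverable (fun x y => [/\ A x y, agree n y v &
                      exists2 y', agree n y' u & A x y'])].
Proof.
move=> anA ncA; apply: contrapT => nsplit; apply: ncA.
pose Sp n (u v : baire) x y := [/\ A x y, agree n y v &
  exists2 y', agree n y' u & A x y'].
(* Finite sequences, padded by 0, replace the infinite [u] and [v]: only their first [n] digits
   matter, and the index type becomes countable. *)
pose I := (nat * (seq nat * seq nat))%type.
pose ok (i : I) := l <= i.1 /\ ~ agree i.1 (nth 0 i.2.1) (nth 0 i.2.2).
pose F (i : I) x y := ok i /\ Sp i.1 (nth 0 i.2.1) (nth 0 i.2.2) x y.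
have cF : coverable (fun x y => exists i, F i x y).
  apply: (@coverable_bigcup I F) => // i; apply: coverable_when => -[li ni].
  by apply: contrapT => h; apply: nsplit;
    exists i.1, (nth 0 i.2.1), (nth 0 i.2.2).
have [f bf fP] := cF.
pose A0 x y := A x y /\ forall k, y <> f k x.
have cA0 : coverable A0.
  apply: coverable_functional.
    apply: analytic_and => //; apply: bor_analytic; apply: sgen_all => k.
    apply: (@sgen_iff _ _ (fun p => exists n, bsnd p n <> f k (bfst p) n)).
      move=> p; split=> [[n h] e|ne]; first by apply: h; rewrite e.
      apply: contrapT => h; apply: ne; apply/funext => n.
      by apply: contrapT => ?; apply: h; exists n.
    apply: sgen_ex => n.
    exact: (bor_map_digit2 n (fun a b =>
      a <> b) bor_map_snd (bor_map_comp (bf k) bor_map_fst)).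
  move=> x y y' [Ay ny] [Ay' ny']; apply: contrapT => yy'.
  have [k yk] : exists k, y' k <> y k.
    apply: contrapT => h; apply: yy'; apply/funext => k.
    by apply: contrapT => ?; apply: h; exists k; exact: nesym.
  pose n := maxn l k.+1.
  have mkP (z : baire) : agree n z (nth 0 (mkseq z n)).
    by move=> j jn; rewrite nth_mkseq.
  suff /fP[j] : exists i, F i x y by exact: ny.
  (* The other value [y'] shows that [(x, y)] lies in one of the parts already covered by [f]. *)
  exists (n, (mkseq y' n, mkseq y n)); split; last first.
    by split=> //; exists y'.
  split; first exact: leq_maxl.
  have kn : k < n by exact: leq_maxr.
  by move=> /(_ k kn); rewrite /= !nth_mkseq.
apply: (@coverable_bigcup bool
    (fun b => if b then A0 else fun x y => exists k, y = f k x)).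
  move=> x y Axy; have [h|h] := pselect (exists k, y = f k x).
    by exists false.
  by exists true; split=> // k yk; apply: h; exists k.
by case=> //; exists f.
Qed.

(** Otherwise repeated splitting keeps an uncoverable part while the sections of its points are
    forced to meet more and more disjoint boxes. Fusing the point, its values and their witnesses
    together yields one point with infinitely many values. *)
Lemma coverable_finite_sections A : analytic2 A ->
  (forall x, finite_set [set y | A x y]) -> coverable A.
Proof.
move=> anA finA; apply: contrapT => ncA.
have [C cC AzC] : exists2 C, closed2 C &
    forall x y, A x y <-> exists z, C (bpair x y) z.
  have [C cC h] := anA; exists C => // x y.
  by have := h (bpair x y); rewrite /= bfst_pair bsnd_pair.
(* One entry holds a digit of [x] and, for each [i], digits of [y_i] and of its witness [z_i]. *)
pose V := (nat * (nat -> nat * nat))%type.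
pose X (s : nat -> V) : baire := fun k => (s k).1.
pose Y i (s : nat -> V) : baire := fun k => ((s k).2 i).1.
pose Z i (s : nat -> V) : baire := fun k => ((s k).2 i).2.
pose B l q w x y := agree l y q /\ exists2 z, agree l z w & C (bpair x y) z.
(* The current value [y] lies in box [m], while the section of [x] also meets each earlier box. *)
pose K m l s x y := [/\ agree l x (X s), B l (Y m s) (Z m s) x y &
  forall i, i < m -> exists y', B l (Y i s) (Z i s) x y'].
have anB l q w : analytic2 (B l q w).
  apply: analytic_and.
    exact: (analytic_preimage nonexpansive_snd (analytic_agree l q)).
  have anC : analytic [set t | C (bfst t) (bsnd t)].
    apply: analytic_closed => t h; apply: cC => n; have [t' tt' Ct'] := h n.
    exists (bfst t'), (bsnd t'); split=> //;
      [exact: nonexpansive_fst|exact: nonexpansive_snd].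
  have ne : nonexpansive (fun t =>
    bpair (bpair (bfst (bfst t)) (bsnd (bfst t))) (bsnd t)).
    apply: nonexpansive_pair nonexpansive_snd; apply: nonexpansive_pair.
      exact: (nonexpansive_comp nonexpansive_fst nonexpansive_fst).
    exact: (nonexpansive_comp nonexpansive_snd nonexpansive_fst).
  have := analytic_proj (analytic_and
    (analytic_preimage nonexpansive_snd (analytic_agree l w))
    (analytic_preimage ne anC)).
  apply: analytic_iff => p; split.
    by move=> [z /=]; rewrite !bfst_pair !bsnd_pair => -[? ?]; exists z.
  by move=> [z h1 h2]; exists z => /=; rewrite !bfst_pair !bsnd_pair.
have anK m l s : analytic2 (K m l s).
  have an1 := analytic_preimage nonexpansive_fst (analytic_agree l (X s)).
  have an2 := anB l (Y m s) (Z m s).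
  have an3 : analytic [set p : baire | forall i, i < m -> exists y',
    B l (Y i s) (Z i s) (bfst p) y'].
    apply: analytic_all => i; case: (ltnP i m) => im; last first.
      by apply: analytic_iff (analytic_digit 0 (fun=> True)) => p; split.
    have := analytic_preimage nonexpansive_fst (analytic_proj (anB l (Y i s) (Z
      i s))).
    apply: analytic_iff => p; split=> [[y]|/(_ isT)[y h]]; last exists y;
      rewrite /= bfst_pair bsnd_pair//.
    by exists y.
  by apply: analytic_iff (analytic_and an1 (analytic_and an2 an3)) => p;
    split=> [[? []]|[]].
pose P m l s := [/\ ~ coverable (K m l s),
  forall k i, k < l -> m <= i -> (s k).2 i = (s k).2 m &
  forall i j, i < j -> j <= m -> exists2 k, k < l & Y i s k <> Y j s k].
(* A state [s] holds the prefixes of [x], of the points [y_i] and of their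
   witnesses [z_i]; at stage [m] the points [y_0, ..., y_m] are already pairwise
   distinct, and the prefixes with index beyond [m] still copy those of [y_m]. *)
have [||s sP] := @fusion V P.
- exists 0, (fun=> (0, fun=> (0, 0))); split=> //; last first.
    by move=> i j ij; rewrite leqNgt (leq_ltn_trans (leq0n i) ij).
  move=> cK; apply: ncA; apply: coverable_sub cK => x y /AzC[z Cz].
  by split=> //; split=> //; exists z.
- move=> m l s [ncK stab dis].
  (* Splitting beyond [l] makes the prefix length grow strictly. The string [u] will continue [y_m],
     and [v] will start the new point [y_(m+1)]. *)
  have [n [u [v [ln uv ncSp]]]] := not_coverable_split l.+1 (anK m l s) ncK.
  (* The table [q] supplies the digits from [l] on. Capping the index at [m.+1] makes all later
     slots copy the newest point. *)
  pose t (q : seq (nat * seq (nat * nat))) : nat -> V := fun k =>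
    if k < l then s k else
    let p := nth (0, [::]) q k in (p.1, fun i => nth (0, 0) p.2 (minn i m.+1)).
  pose ok q := forall i j, i < j -> j <= m.+1 -> exists2 k,
    k < n & Y i (t q) k <> Y j (t q) k.
  suff [q [okq ncq]] : exists q, ok q /\ ~ coverable (K m.+1 n (t q)).
    exists n, (t q); split=> //; first by move=> k kl; rewrite /t kl.
    split=> // k i kn mi; rewrite /t; case: (ltnP k l) => kl /=.
      by rewrite stab ?(ltnW mi)// [RHS]stab.
    by rewrite (minn_idPr mi) minnn.
  (* There are countably many tables, so if each gave a coverable part, the split relation would be
     coverable. *)
  apply: contrapT => nq; apply: ncSp.
  apply: (@coverable_bigcup _ (fun q x y => ok q /\ K m.+1 n (t q) x y));
    last first.
    move=> q; apply: coverable_when => okq.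
    by apply: contrapT => ?; apply: nq; exists q.
  move=> x y [[xs [ys [z zs Cz]] Ks] yv [y' y'u [_ [y's [z' z's Cz']] _]]].
  have /choice[yz yzP] : forall i, exists yz : baire * baire, i < m ->
      [/\ agree l yz.1 (Y i s), agree l yz.2 (Z i s) & C (bpair x yz.1) yz.2].
    move=> i; case: (ltnP i m) => im; last by exists (x, x).
    by have [a [ai [b bi Cab]]] := Ks i im; exists (a, b).
  (* Slot [m] is frozen at the other value [y'], and the current value [y] moves to slot [m.+1]. *)
  pose w i := if i < m then yz i else if i == m then (y', z') else (y, z).
  pose q := mkseq (fun k => (x k, mkseq (fun i => ((w i).1 k,
    (w i).2 k)) m.+2)) n.
  have sm1 k : k < l -> (s k).2 m.+1 = (s k).2 m by move=> kl; exact: stab.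
  have ws i : i <= m.+1 -> [/\ agree l (w i).1 (Y i s),
    agree l (w i).2 (Z i s) & C (bpair x (w i).1) (w i).2].
    move=> im1; rewrite /w; case: ltnP => im; first exact: yzP.
    case: eqVneq => [->|nim]//; have -> : i = m.+1.
      by apply/eqP; rewrite eqn_leq im1 ltn_neqAle eq_sym nim im.
    by split=> // k kl; [rewrite /= ys|rewrite /= zs] => //; rewrite /Y /Z sm1.
  have qE k : l <= k -> k < n -> t q k = (x k, fun i => ((w (minn i m.+1)).1 k,
    (w (minn i m.+1)).2 k)).
    move=> lk kn; rewrite /t ltnNge lk /= nth_mkseq//=; congr pair.
    by apply/funext => i; rewrite nth_mkseq// ltnS geq_minr.
  have xt : agree n x (X (t q)).
    move=> k kn; rewrite /X; case: (ltnP k l) => kl; last by rewrite qE.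
    by rewrite /t kl xs.
  have wt i : i <= m.+1 -> agree n (w i).1 (Y i (t q)) /\
    agree n (w i).2 (Z i (t q)).
    move=> im; have [h1 h2 _] := ws i im; split=> k kn; rewrite /Y /Z;
      case: (ltnP k l) => kl.
    - by rewrite /t kl h1.
    - by rewrite qE//= (minn_idPl im).
    - by rewrite /t kl h2.
    - by rewrite qE//= (minn_idPl im).
  have wm1 : w m.+1 = (y, z) by rewrite /w ltnNge leqnSn /= eqn_leq ltnn.
  have tY i k : k < l -> Y i (t q) k = Y i s k by rewrite /Y /t => ->.
  exists q; split.
    move=> i j ij; rewrite leq_eqVlt => /orP[/eqP jm|jm]; last first.
      have [k kl h] := dis i j ij jm; exists k; last by rewrite !tY.
      by rewrite (ltn_trans kl).
    (* The new point differs from [y_m] because [u] and [v] differ, and from the earlier points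
       because it agrees with [y_m] below [l]. *)
    subst j; move: ij; rewrite ltnS leq_eqVlt => /orP[/eqP->|im].
      have [k kn uvk] : exists2 k, k < n & u k <> v k.
        by apply: contrapT => h; apply: uv => k kn; apply: contrapT => ?;
          apply: h; exists k.
      exists k => //; have [<- // _] := wt m (leqnSn m);
        have [<- // _] := wt m.+1 (leqnn _).
      by rewrite wm1 /w ltnn eqxx /= yv// y'u.
    have [k kl h] := dis i m im (leqnn _); exists k;
      first by rewrite (ltn_trans kl).
    by rewrite !tY// {2}/Y sm1.
  split=> //.
    by have [h1 h2] := wt m.+1 (leqnn _); move: h1 h2; rewrite wm1 => h1 h2;
      split=> //; exists z.
  move=> i im; have [_ _ h] := ws i (ltnW im); have [h1 h2] := wt i (ltnW im).
  by exists (w i).1; split=> //; exists (w i).2.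
have inA i : A (X s) (Y i s).
  apply/AzC; exists (Z i s); apply: cC => n.
  (* A stage beyond both [n] and [i] is uncoverable, hence nonempty, and constrains slot [i] to
     length at least [n]; closedness of [C] then passes to the limit. *)
  have [l [t [ml ts [ncK _ _]]]] := sP (maxn n i.+1).
  have [x [y [xt _ /(_ i (leq_maxr _ _))[y' [y't [z' z't Cz']]]]]] : exists x y,
    K (maxn n i.+1) l t x y.
    apply: contrapT => h; apply: ncK; exists (fun=> id) => [_|x y Kxy];
      first exact: bor_map_id.
    by case: h; exists x, y.
  have nl : n <= l by apply: leq_trans ml; exact: leq_maxl.
  exists (bpair x y'), z'; split=> // k kn; have kl := leq_trans kn nl.
    by rewrite /bpair xt// y't// /X /Y ts.
  by rewrite z't// /Z ts.
have injY : injective (fun i => Y i s).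
  suff H i j : i < j -> Y i s <> Y j s.
    move=> i j e; case: (ltngtP i j) => // /H ne;
      [case: (ne e)|case: (ne (esym e))].
  move=> ij e; have [l [t [_ ts [_ _ /(_ i j ij (leqnn _))[k kl]]]]] := sP j.
  by apply; rewrite /Y ts// -/(Y i s k) e.
apply: infinite_nat.
have := @finite_preimage _ _ [set y | A (X s) y] (fun i => Y i s)
  (fun i j _ _ e => injY i j e) (finA (X s)).
by apply: sub_finite_set => i _; exact: inA.
Qed.

(** * Coding a Polish space in Baire space *)

(** By [code_base] every open set is a union of sets that prescribe one digit, hence a countable
    union. This transfers Borel sets between [T] and Baire space. *)
Record coding (T : topologicalType) (code : T -> baire) : Prop := Coding {
  code_inj : injective code;
  code_bor : bor_map open code;
  code_range : bor (range code);
  code_base : forall (A : set T) x, open A -> A x ->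
    exists n, forall y, code y n = code x n -> A y }.

Lemma dense_sequence (T : topologicalType) (D : set T) : T -> countable D ->
  dense D -> exists q : nat -> T, forall A : set T, open A -> A !=set0 ->
    exists j, A (q j).
Proof.
move=> x0 /countable_injP[f injf] denD.
have /choice[q qP] : forall n, exists x, (exists2 y, D y & f y = n) -> D x /\
  f x = n.
  move=> n; have [[y Dy fy]|h] := pselect (exists2 y, D y & f y = n).
    by exists y.
  by exists x0 => /h.
exists q => A oA A0; have [x [Ax Dx]] := denD A A0 oA.
exists (f x); have [Dq fq] := qP (f x) (ex_intro2 _ _ x Dx erefl).
by rewrite (injf (q (f x)) x) ?inE.
Qed.

(** Digit [n] tells whether the point lies in the [n]-th open ball, the centers running through a
    dense sequence and the radii through a null sequence. Completeness is what identifies the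
    range. *)
Lemma polish_coding (R : realType) (T : topologicalType) : polish R T -> T ->
  exists code : T -> baire, coding code.
Proof.
move=> [[D cD denD] [d [[d0 dC dT] openE complete]]] x0.
have [q qP] := dense_sequence x0 cD denD.
have dxx x : d x x = 0%R by apply/d0.
have d_ge0 x y : (0 <= d x y)%R by have := dT x y x; rewrite dxx (dC y x); lra.
have open_ball x e : open [set y | (d y x < e)%R].
  apply/openE => y /= yx; exists (e - d y x)%R; first by lra.
  by move=> z yz; have := dT z y x; rewrite (dC z y); lra.
(* The radii are [1/(m+1)]; the sequel sees them only through positivity, monotonicity and
   smallness. *)
have [i [i_gt0 i_le small]] : exists i : nat -> R, [/\ forall m, (0 < i m)%R,
    forall m k, m <= k -> (i k <= i m)%R &
    forall e, (0 < e)%R -> exists m, (i m < e)%R].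
  exists (fun m => m.+1%:R^-1%R); split.
  - by move=> m; rewrite invr_gt0 ltr0n.
  - by move=> m k mk; rewrite lef_pV2 ?posrE ?ltr0n// ler_nat.
  - by move=> e /ltr_add_invr[m]; rewrite add0r; exists m.
pose c n := q (nunpair n).1; pose r n : R := i (nunpair n).2.
have r_gt0 n : (0 < r n)%R by exact: i_gt0.
have fine x (e : R) : (0 < e)%R -> exists n, (d x (c n) < r n)%R /\ (r n < e)%R.
  move=> /small[m me]; have [|j] :=
    qP [set y | (d y x < i m)%R] (open_ball _ _).
    by exists x => /=; rewrite dxx i_gt0.
  by rewrite /= dC => h; exists (npair j m); rewrite /c /r npairK.
pose code x : baire := fun n => (d x (c n) < r n)%R.
have base (A : set T) x : open A -> A x -> exists n, forall y,
  code y n = code x n -> A y.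
  move=> /openE h /h[e e0 eA].
  have [n [xn ne]] := fine x (e / 2)%R ltac:(by lra).
  exists n => y; rewrite /code xn => yn; apply: eA.
  have {}yn : (d y (c n) < r n)%R by move: yn; case: (_ < _)%R.
  by have := dT x (c n) y; rewrite (dC (c n) y); lra.
have bcode : bor_map open code.
  move=> n k; apply: (@sgen_iff _ _ (fun x =>
    if (d x (c n) < r n)%R then k = 1 else k = 0)).
    by move=> x; rewrite /code; case: ifP => _ /=; split.
  apply: (@sgen_iff _ _ (fun x => ((d x (c n) < r n)%R /\
    k = 1) \/ (~ (d x (c n) < r n)%R /\ k = 0))).
    by move=> x; case: ifP => h; split=> [[[]|[]]|] //; [left|right].
  have oB : <<s open >> [set x | (d x (c n) < r n)%R].
    by apply: sub_sigma_algebra; exact: open_ball.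
  apply: sgen_or; apply: sgen_and;
    [exact: oB|exact: sgen_cst| |exact: sgen_cst].
  exact: sgen_not.
exists code; split=> //.
- move=> x y e; apply: contrapT => xy.
  have dxy : (0 < d x y)%R.
    by rewrite lt_neqAle d_ge0 andbT eq_sym; apply/eqP => /d0.
  have [n h] := base [set z | (d z x < d x y)%R] x (open_ball _ _) ltac:(by
    rewrite /= dxx).
  by have := h y; rewrite e => /(_ erefl) /=; rewrite dC ltxx.
(* [ok] axiomatises the codes: it is a countable combination of digit
   conditions, whence the range of [code] is Borel. *)
pose ok (b : baire) := [/\ forall n, b n = 0 \/ b n = 1,
  forall m, exists n, b n = 1 /\ (r n < i m)%R,
  forall n n', b n = 1 -> b n' = 1 -> (d (c n) (c n') < r n + r n')%R &
  forall n, b n = 1 <-> exists n', b n' = 1 /\ (d (c n) (c n') + r n' < r n)%R].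
have bok : bor [set b | ok b].
  apply: (@sgen_iff _ _ (fun b => (forall n, b n = 0 \/ b n = 1) /\
    (forall m, exists n, b n = 1 /\ (r n < i m)%R) /\
    (forall n n', b n = 1 -> b n' = 1 -> (d (c n) (c n') < r n + r n')%R) /\
    (forall n, (b n = 1 -> exists n', b n' = 1 /\
      (d (c n) (c n') + r n' < r n)%R) /\
      ((exists n', b n' = 1 /\ (d (c n) (c n') + r n' < r n)%R) -> b n = 1)))).
    move=> b; split; first by move=> [? [? [? h]]]; split=> // n;
      have [] := h n; split.
    by move=> [? ? ? h]; do 3 (split=> //); move=> n; have [] := h n.
  have bex n : bor [set b : baire | exists n', b n' = 1 /\
    (d (c n) (c n') + r n' < r n)%R].
    by apply: sgen_ex => n'; apply: sgen_and;
      [exact: bor_digit|exact: sgen_cst].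
  apply: sgen_and; first by apply: sgen_all => n; apply: sgen_or;
    exact: bor_digit.
  apply: sgen_and.
    apply: sgen_all => m; apply: sgen_ex => n.
    by apply: sgen_and; [exact: bor_digit|exact: sgen_cst].
  apply: sgen_and.
    apply: sgen_all => n; apply: sgen_all => n'.
    apply: sgen_imp; first exact: bor_digit.
    by apply: sgen_imp; [exact: bor_digit|exact: sgen_cst].
  apply: sgen_all => n; apply: sgen_and; apply: sgen_imp.
  - exact: bor_digit.
  - exact: bex.
  - exact: bex.
  - exact: bor_digit.
apply: sgen_iff bok => b; split; last first.
  move=> [x _ <-]; have codeE n : code x n = 1 <-> (d x (c n) < r n)%R.
    by rewrite /code; case: (_ < _)%R.
  split.
  - by move=> n; rewrite /code; case: (_ < _)%R; [right|left].
  - move=> m; have [|n [h1 h2]] := fine x (i m); first by rewrite i_gt0.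
    by exists n; rewrite codeE.
  - move=> n n'; rewrite !codeE => h h'.
    by have := dT (c n) x (c n'); rewrite (dC (c n) x); lra.
  - move=> n; rewrite codeE; split=> [h|[n' [/codeE h h']]].
      have [|n' [h1 h2]] := fine x ((r n - d x (c n)) / 2)%R; first by lra.
      exists n'; rewrite codeE; split=> //.
      by have := dT (c n) x (c n'); rewrite (dC (c n) x); lra.
    by have := dT x (c n') (c n); rewrite (dC (c n') (c n)); lra.
move=> [b01 bsmall bnear bE].
(* The centers of selected balls with radii below [i m] form a Cauchy sequence; its limit will have
   code [b]. *)
have /choice[n nP] := bsmall.
have [|x xP] := complete (fun m => c (n m)).
  move=> e e0; have [N Ne] := small (e / 2)%R ltac:(by lra).
  exists N => m m' Nm Nm'.
  have := bnear _ _ (nP m).1 (nP m').1; have := (nP m).2; have := (nP m').2.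
  by have := i_le _ _ Nm; have := i_le _ _ Nm'; lra.
(* The limit gives only a non-strict inequality; the last clause of [ok], a formal inclusion of a
   smaller selected ball, restores strictness. *)
have near k : b k = 1 -> (d x (c k) <= r k)%R.
  move=> bk; rewrite leNgt; apply/negP => h.
  pose e := ((d x (c k) - r k) / 2)%R; have e0 : (0 < e)%R by rewrite /e; lra.
  have [N NP] := xP e e0; have [M Me] := small e e0.
  have := NP (maxn N M) (leq_maxl _ _).
  have := bnear _ _ (nP (maxn N M)).1 bk; have := (nP (maxn N M)).2.
  have := i_le _ _ (leq_maxr N M).
  have := dT x (c (n (maxn N M))) (c k); rewrite (dC x (c (n _))).
  by move: Me; rewrite /e; lra.
exists x => //; apply/funext => k.
have : (d x (c k) < r k)%R <-> b k = 1.
  split=> [h|/bE[k' [/near h h']]]; last first.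
    by have := dT x (c k') (c k); rewrite (dC (c k') (c k)); lra.
  have [M Me] := small ((r k - d x (c k)) / 2)%R ltac:(by lra).
  apply/bE; exists (n M); split; first exact: (nP M).1.
  have := near _ (nP M).1; have := (nP M).2; have := dT (c k) x (c (n M)).
  by rewrite (dC (c k) x); lra.
rewrite /code; case: (_ < _)%R => -[h1 h2]; first by rewrite h1.
by case: (b01 k) => // /h2.
Qed.

(** * Borel sets and maps on a coded space *)

Lemma ptws_open_box (T : topologicalType) k (O : set {ptws 'I_k -> T})
    (v : {ptws 'I_k -> T}) : open O -> O v ->
  exists2 A : 'I_k -> set T, forall i, open (A i) /\ A i (v i) &
    forall w : 'I_k -> T, (forall i, A i (w i)) -> O w.
Proof.
move=> oO Ov.
pose D := [set A : 'I_k -> set T | forall i, open (A i) /\ A i (v i)].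
(* The filter of open boxes around [v] converges to [v] coordinatewise, hence in the product
   topology, so it contains [O]. *)
pose F : set_system ('I_k -> T) :=
  filter_from D (fun A => [set w | forall i, A i (w i)]).
have FF : Filter F.
  apply: filter_from_filter; first by exists (fun=> setT) => i; split=> //;
    exact: openT.
  move=> A B DA DB; exists (fun i => A i `&` B i).
    by move=> i; have [? ?] := DA i; have [? ?] := DB i; split=> //;
      exact: openI.
  by move=> w h; split=> i; have [] := h i.
suff cvF : F --> (v : {ptws 'I_k -> T}).
  have [A DA h] : F O by apply: cvF; apply: open_nbhs_nbhs; split.
  by exists A.
apply/cvg_sup => i B; rewrite nbhsE => -[B' [[C oC CB'] B'v] B'B].
exists (fun j => if j == i then C else setT).
  move=> j; case: eqP => [->|_]; last by split=> //; exact: openT.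
  by split=> //; move: B'v; rewrite -CB'.
move=> w /= h; apply: B'B; rewrite -CB' /=.
by have := h i; rewrite eqxx.
Qed.

Lemma sgen_pullback (X Y : Type) (G : set (set X)) (H : set (set Y)) (h : X ->
  Y) :
  (forall A, G A -> exists2 B, <<s H >> B & forall x, A x <-> B (h x)) ->
  forall A, <<s G >> A -> exists2 B, <<s H >> B & forall x, A x <-> B (h x).
Proof.
move=> GH A GA.
have SA : sigma_algebra setT
    [set A | exists2 B, <<s H >> B & forall x, A x <-> B (h x)].
  split.
  - by exists set0; first exact: sigma_algebra0.
  - move=> B [C HC BC]; exists (~` C); first exact: sgen_not.
    by move=> x; rewrite setTD /setC /=; split=> nB /BC.
  - move=> F HF'.
    have /choice[B BP] : forall n, exists B, <<s H >> B /\ forall x, F n x <->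
      B (h x).
      by move=> n; have [B] := HF' n; exists B.
    exists (\bigcup_n B n).
      by apply: sigma_algebra_bigcup => n; exact: (BP n).1.
    by move=> x; split=> -[n _ ?]; exists n => //; apply/(BP n).2.
by apply: (GA _ (conj SA _)) => B /GH.
Qed.

Section coded_space.
Context {T : topologicalType} {code : T -> baire} (codeT : coding code).
Local Notation borT := (<<s [set A : set T | open A] >>).

Definition borel_map (f : T -> T) := forall A, borT A -> borT (f @^-1` A).

Lemma borel_map_id : borel_map id. Proof. by []. Qed.

Lemma borel_map_comp f g : borel_map f -> borel_map g -> borel_map (f \o g).
Proof. by move=> bf bg A /bf/bg. Qed.

Lemma borel_map_code f : borel_map f -> bor_map [set A :
  set T | open A] (code \o f).
Proof. by move=> bf n i; exact: (bf _ (code_bor codeT n i)). Qed.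

Lemma borel_pullback (A : set T) : borT A ->
  exists2 B, bor B & forall x, A x <-> B (code x).
Proof.
apply: sgen_pullback => {}A oA.
pose ok (ni : nat * nat) := forall y, code y ni.1 = ni.2 -> A y.
exists [set b | exists ni, ok ni /\ b ni.1 = ni.2].
  by apply: sgen_ex => ni; apply: sgen_when => _; exact: bor_digit.
move=> x; split=> [Ax|[ni [okni]]]; last exact: okni.
have [n h] := code_base codeT oA Ax.
by exists (n, code x n).
Qed.

Lemma borel_pullback2 (A : set (T * T)) : borel A ->
  exists2 B, bor B & forall x y, A (x, y) <-> B (bpair (code x) (code y)).
Proof.
move=> bA.
suff [B bB BP] : exists2 B, bor B &
    forall p : T * T, A p <-> B (bpair (code p.1) (code p.2)).
  by exists B => // x y; exact: (BP (x, y)).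
move: A bA; apply: sgen_pullback => A oA.
(* Open sets of the product are countable unions of rectangles that prescribe one digit in each
   coordinate. *)
pose ok (i : (nat * nat) * (nat * nat)) := forall x y,
  code x i.1.1 = i.1.2 -> code y i.2.1 = i.2.2 -> A (x, y).
exists [set b | exists i, ok i /\ (bfst b i.1.1 = i.1.2 /\
  bsnd b i.2.1 = i.2.2)].
  apply: sgen_ex => i; apply: sgen_when => _.
  by apply: sgen_and; [exact: bor_map_fst|exact: bor_map_snd].
move=> [x y]; rewrite /= bfst_pair bsnd_pair.
split=> [Axy|[i [oki [/oki h /h]]]//].
have /open_nbhs_nbhs [[B C] /= [nB nC] BCA] : open_nbhs (x, y) A by [].
move: nB nC; rewrite !nbhsE /= => -[B' [oB' B'x] B'B] [C' [oC' C'y] C'C].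
have [n hn] := code_base codeT oB' B'x; have [m hm] := code_base codeT oC' C'y.
exists ((n, code x n), (m, code y m)); split=> // x' y' /= ex ey.
by apply: BCA; split; [exact/B'B/hn|exact/C'C/hm].
Qed.

Lemma borel_map_eq f g : borel_map f -> borel_map g -> borT [set x | f x = g x].
Proof.
move=> bf bg; apply: (@sgen_iff _ _ (fun x => forall n,
  code (f x) n = code (g x) n)).
  move=> x; split=> [h|-> //]; apply: (code_inj codeT); exact/funext.
apply: sgen_all => n.
exact: (bor_map_digit2 n (fun a b =>
  a = b) (borel_map_code bf) (borel_map_code bg)).
Qed.

Lemma borel_map_rel f g (A : set (T * T)) : borel_map f -> borel_map g ->
  borel A -> borT [set x | A (f x, g x)].
Proof.
move=> bf bg /borel_pullback2[B bB AB].
apply: (@sgen_iff _ _ (fun x => B (bpair (code (f x)) (code (g x))))).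
  by move=> x; rewrite AB.
exact: (bor_map_preimage (bor_map_pair (borel_map_code bf) (borel_map_code bg))
  bB).
Qed.

Lemma borel_map_tuple k (f : 'I_k -> T -> T) (A : set {ptws 'I_k -> T}) :
  (forall i, borel_map (f i)) -> borel A -> borT [set x | A (fun i => f i x)].
Proof.
move=> bf; move: A.
apply: (@sgen_preimage _ _ _ _ (fun x i => f i x : T)) => A oA.
(* One prescribed digit per coordinate: with finitely many coordinates there are countably many such
   boxes. *)
pose ok (s : {ffun 'I_k -> nat * nat}) := forall w : 'I_k -> T,
  (forall i, code (w i) (s i).1 = (s i).2) -> A w.
apply: (@sgen_iff _ _ (fun x => exists s, ok s /\
    forall i, code (f i x) (s i).1 = (s i).2)).
  move=> x; split=> [[s [oks]]|Ax]; first exact: oks.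
  have [B BP BA] := ptws_open_box oA Ax.
  have /choice[n nP] : forall i, exists n, forall y,
    code y n = code (f i x) n -> B i y.
    by move=> i; have [oB Bx] := BP i; exact: (code_base codeT oB Bx).
  exists [ffun i => (n i, code (f i x) (n i))]; split=> [w h|i];
    last by rewrite ffunE.
  by apply: BA => i; apply: nP; have := h i; rewrite ffunE.
apply: sgen_ex => s; apply: sgen_when => _; apply: sgen_all => i.
exact: (borel_map_code (bf i)).
Qed.

Definition code_lt x y :=
  exists n, agree n (code x) (code y) /\ code x n < code y n.

Lemma code_lt_linear : linear_order code_lt.
Proof.
split.
- by move=> x [n [_]]; rewrite ltnn.
- move=> x y z [n [h1 h2]] [m [h3 h4]]; exists (minn n m).
  split; first by move=> k; rewrite leq_min => /andP[kn km]; rewrite h1// h3.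
  case: (ltngtP n m) => nm.
  + by rewrite -h3.
  + by rewrite h1.
  + by rewrite nm in h1 h2 *; exact: ltn_trans h4.
- move=> x y; have [e|ne] := pselect (code x = code y).
    by constructor 2; exact: (code_inj codeT).
  have ex : exists n, code x n != code y n.
    apply: contrapT => h; apply: ne; apply/funext => n.
    by apply/eqP; apply: contrapT => /negP ?; apply: h; exists n.
  have [n nn min] := ex_minnP ex.
  have ag : agree n (code x) (code y).
    by move=> k kn; apply/eqP; apply: contraTT kn => /min; rewrite -leqNgt.
  by case: (ltngtP (code x n) (code y n)) nn => // lt _;
    [constructor 1|constructor 3];
    exists n; split=> //; exact: agree_sym.
Qed.

Lemma borel_map_lt f g : borel_map f -> borel_map g ->
  borT [set x | code_lt (f x) (g x)].
Proof.
move=> bf bg; apply: sgen_ex => n; apply: sgen_and.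
  apply: sgen_all => k; apply: sgen_imp; first exact: sgen_cst.
  exact: (bor_map_digit2 k (fun a b =>
    a = b) (borel_map_code bf) (borel_map_code bg)).
exact: (bor_map_digit2 n (fun a b =>
  a < b) (borel_map_code bf) (borel_map_code bg)).
Qed.

(** The relation is moved to codes and covered there. A covering value that is no code is decoded as
    the argument itself. *)
Lemma borel_locally_finite_cover (E : T -> T -> Prop) :
  borel [set p : T * T | E p.1 p.2] -> (forall x, finite_set [set y | E x y]) ->
  exists2 F : nat -> T -> T, forall k, borel_map (F k) &
    forall x y, E x y -> exists k, y = F k x.
Proof.
move=> bE finE; have [B bB EB] := borel_pullback2 bE.
(* Outside the range of [code] the set [B] is arbitrary, so the restriction is what makes sections
   finite. *)
pose E' a b := (range code a /\ range code b) /\ B (bpair a b).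
have [||f bf fP] := @coverable_finite_sections E'.
- apply: bor_analytic; apply: sgen_and; first apply: sgen_and.
  + exact: (bor_map_preimage bor_map_fst (code_range codeT)).
  + exact: (bor_map_preimage bor_map_snd (code_range codeT)).
  + exact: (bor_map_preimage (bor_map_pair bor_map_fst bor_map_snd) bB).
- move=> a; have [[x _ <-]|na] := pselect (range code a); last first.
    by apply: sub_finite_set (finite_set0 baire) => b [[]].
  apply: sub_finite_set (finite_image code (finE x)) =>
    b [[_ [y _ <-]] /EB Exy].
  by exists y.
have /choice[F FP] : forall kx : nat * T, exists y,
  code y = f kx.1 (code kx.2) \/
    y = kx.2 /\ ~ range code (f kx.1 (code kx.2)).
  move=> [k x] /=; have [[y _ e]|h] := pselect (range code (f k (code x))).
    by exists y; left.
  by exists x; right.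
exists (fun k x => F (k, x)) => [k A bA|x y Exy]; last first.
  have [|k e] := fP (code x) (code y).
    by split; [split; [exists x|exists y]|apply/EB].
  exists k; case: (FP (k, x)) => /= [e'|[_ []]]; last by exists y.
  by apply: (code_inj codeT); rewrite e' e.
have [C bC AC'] := borel_pullback bA.
have bfc : bor_map [set A : set T | open A] (f k \o code).
  exact: (bor_map_comp (bf k) (code_bor codeT)).
have bR := bor_map_preimage bfc (code_range codeT).
apply: (@sgen_iff _ _ (fun x => (range code (f k (code x)) /\
  C (f k (code x))) \/
    (~ range code (f k (code x)) /\ A x))).
  move=> x; rewrite /= AC'; case: (FP (k, x)) => /= [e|[-> nr]].
    by rewrite AC' -e; split=> [[[]//|[[]//]]|?]; [exists (F (k, x))|left;
      split=> //; exists (F (k, x))].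
  by rewrite -AC'; split=> [[[]//|[]//]|?]; right.
apply: sgen_or; first by apply: sgen_and => //;
  exact: (bor_map_preimage bfc bC).
by apply: sgen_and => //; exact: sgen_not.
Qed.

End coded_space.

(** * Borel colorings from local rules *)

Section word_relations.
Context {T : topologicalType} (F : nat -> T -> T).
Context (bF : forall k, borel_map (F k)).
Local Notation borT := (<<s [set A : set T | open A] >>).

Definition wmap (w : seq nat) (x : T) : T := foldl (fun y k => F k y) x w.

Lemma wmap_cat w u x : wmap (w ++ u) x = wmap u (wmap w x).
Proof. by rewrite /wmap foldl_cat. Qed.

Lemma borel_wmap w : borel_map (wmap w).
Proof.
elim: w => [|k w IH]; first exact: borel_map_id.
exact: (borel_map_comp IH (bF k)).
Qed.

Definition reach x y := exists w, y = wmap w x.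

Lemma reach_trans y x z : reach x y -> reach y z -> reach x z.
Proof. by move=> [w ->] [u ->]; exists (w ++ u); rewrite wmap_cat. Qed.

(** Testing [E] only along words turns quantifiers over reachable points into countable quantifiers
    over words. *)
Definition borel_rel (E : T -> T -> Prop) :=
  forall w v, borT [set x | E (wmap w x) (wmap v x)].

Lemma borel_rel_iff E E' : (forall x y, E x y <-> E' x y) ->
  borel_rel E -> borel_rel E'.
Proof. by move=> EE' bE w v; apply: sgen_iff (bE w v) => x. Qed.

(** The intermediate point is reachable from [wmap w x], hence of the form [wmap (w ++ u) x]. *)
Lemma borel_rel_comp E E' : borel_rel E -> borel_rel E' ->
  (forall x y, E x y -> reach x y) ->
  borel_rel (fun x y => exists2 z, E x z & E' z y).
Proof.
move=> bE bE' rE w v.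
apply: (@sgen_iff _ _ (fun x => exists u, E (wmap w x) (wmap (w ++ u) x) /\
    E' (wmap (w ++ u) x) (wmap v x))).
  move=> x; split=> [[u [h h']]|[z h h']]; first by exists (wmap (w ++ u) x).
  by have [u zu] := rE _ _ h; exists u; rewrite wmap_cat -zu.
by apply: sgen_ex => u; apply: sgen_and; [exact: bE|exact: bE'].
Qed.

Lemma walk_reach E n x y : (forall x y, E x y -> reach x y) ->
  walk E n x y -> reach x y.
Proof.
move=> rE; elim: n x => [|n IH] x /=; first by move=> ->; exists [::].
by move=> [z /rE xz /IH]; exact: reach_trans.
Qed.

Lemma borel_rel_unary (A : set T) : borT A -> borel_rel (fun x _ => A x).
Proof. by move=> bA w v; exact: (borel_wmap w bA). Qed.

Lemma borel_rel_unary2 (A : set T) : borT A -> borel_rel (fun _ y => A y).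
Proof. by move=> bA w v; exact: (borel_wmap v bA). Qed.

Lemma borel_rel_and E E' : borel_rel E -> borel_rel E' ->
  borel_rel (fun x y => E x y /\ E' x y).
Proof. by move=> bE bE' w v; apply: sgen_and; [exact: bE|exact: bE']. Qed.

Lemma borel_rel_not E : borel_rel E -> borel_rel (fun x y => ~ E x y).
Proof. by move=> bE w v; apply: sgen_not; exact: bE. Qed.

Lemma borel_rel_ex (I : countType) (E : I -> T -> T -> Prop) :
  (forall i, borel_rel (E i)) -> borel_rel (fun x y => exists i, E i x y).
Proof. by move=> bE w v; apply: sgen_ex => i; exact: bE. Qed.

Lemma borel_rel_cst (p : Prop) : borel_rel (fun _ _ => p).
Proof. by move=> w v; exact: sgen_cst. Qed.

Context (borel_rel_eq : borel_rel eq).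

Lemma borel_rel_walk E n : borel_rel E -> (forall x y, E x y -> reach x y) ->
  borel_rel (walk E n).
Proof.
by move=> bE rE; elim: n => [|n IH] //=; exact: borel_rel_comp.
Qed.

Context {L : language} (G : sgraph L T) {s : nat} (r : nat) (U : 'I_s.+1 ->
  set T)
  (witU : asi_witness G r U) (n : nat).
Context (borU : forall i, borT (U i)).
Context (bor_adj : borel_rel (adj G)).
Context (adj_reach : forall x y, adj G x y -> reach x y).

Let bor_walk m : borel_rel (walk (adj G) m).
Proof. exact: borel_rel_walk. Qed.

Let piece_reach i x y : piece_graph G r U i x y -> reach x y.
Proof. by move=> [_ _ [_ /least_leP[m _]]]; exact: walk_reach. Qed.

Let bor_piece i : borel_rel (piece_graph G r U i).
Proof.
apply: (@borel_rel_iff (fun x y => U i x /\ U i y /\ ~ x = y /\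
    exists m, m <= r /\ walk (adj G) m x y)).
  move=> x y; split.
    move=> [Ux [Uy [xy [m [mr w]]]]]; split=> //; split=> //.
    by apply/least_leP; exists m.
  by move=> [Ux Uy [xy /least_leP[m mr w]]]; do 3 (split=> //); exists m.
apply: borel_rel_and; first exact: borel_rel_unary.
apply: borel_rel_and; first exact: borel_rel_unary2.
apply: borel_rel_and; first exact: borel_rel_not.
by apply: borel_rel_ex => m; apply: borel_rel_and => //; exact: borel_rel_cst.
Qed.

Local Notation cell := (cell_of G r U).

Let cell_reach x y : cell x y -> reach x y.
Proof. by move=> [i _ [m]]; apply: walk_reach; exact: piece_reach. Qed.

Let bor_cell : borel_rel cell.
Proof.
apply: (@borel_rel_iff (fun x y => exists i, U i x /\
    exists m, walk (piece_graph G r U i) m x y)).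
  by move=> x y; split=> [[i [? ?]]|[i ? ?]]; exists i.
apply: borel_rel_ex => i; apply: borel_rel_and; first exact: borel_rel_unary.
by apply: borel_rel_ex => m; apply: borel_rel_walk => //; exact: piece_reach.
Qed.

Let cell_eq x y : cell x = cell y <-> cell x y.
Proof.
split=> [->|xy]; first exact: cell_of_self.
exact: (cells_memE witU (cells_cell_of witU x) xy).
Qed.

(** The pullback of [cell_graph] to vertices, written as a composition of relations to which
    [borel_rel_comp] applies. *)
Let near x y := ~ cell x y /\ exists m, m <= r /\
  exists2 x', cell x x' & exists2 y', walk (adj G) m x' y' & cell y' y.

Let near_reach x y : near x y -> reach x y.
Proof.
move=> [_ [m [_ [x' /cell_reach xx' [y' x'y' /cell_reach y'y]]]]].
by apply: reach_trans xx' _; apply: reach_trans y'y; exact: walk_reach x'y'.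
Qed.

Let bor_near : borel_rel near.
Proof.
apply: borel_rel_and; first exact: borel_rel_not.
apply: borel_rel_ex => m; apply: borel_rel_and; first exact: borel_rel_cst.
apply: borel_rel_comp => //; apply: borel_rel_comp => // x y.
exact: walk_reach.
Qed.

Let cell_graphE x y : cell_graph G r U (cell x) (cell y) <-> near x y.
Proof.
split=> [[_ _ ne /least_leP[m mr [x' [y' [xx' yy' w]]]]]|].
  split; first by move/cell_eq.
  exists m; split=> //; exists x' => //; exists y' => //.
  by apply/cell_eq; apply/esym/cell_eq.
move=> [nxy [m [mr [x' xx' [y' w yy']]]]]; split.
- exact: cells_cell_of.
- exact: cells_cell_of.
- by move/cell_eq.
- apply/least_leP; exists m => //; exists x', y'; split=> //.
  by apply/cell_eq; apply/esym/cell_eq.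
Qed.

(** Every cell entered by an edge is the [cell] of one of its points, so walks between cells lift to
    [near] walks, whose last point is determined only up to its cell. *)
Let walk_cellE m x y : walk (cell_graph G r U) m (cell x) (cell y) <->
  exists2 y', walk near m x y' & cell y' y.
Proof.
elim: m x => [|m IH] x /=.
  by split=> [/cell_eq xy|[_ <-] /cell_eq//]; exists x.
split=> [[D xD Dy]|[y' [z xz zy'] y'y]]; last first.
  by exists (cell z); [apply/cell_graphE|apply/IH; exists y'].
have [_ [i [z [Uz Dz]]] _ _] := xD.
rewrite {}Dz -(cell_ofE witU Uz) in xD Dy.
have [y' zy' y'y] := (IH z).1 Dy.
by exists y' => //; exists z => //; apply/cell_graphE.
Qed.

Definition nbhd_rel x y := cell_nbhd G r U n (cell x) y.

Let nbhd_relE x y : nbhd_rel x y <->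
  exists m, m <= n /\ exists2 y', walk near m x y' & cell y' y.
Proof.
split=> [[D [cD /least_leP[m mn w]] Dy]|[m [mn /walk_cellE w]]].
  exists m; split=> //; apply/walk_cellE.
  by rewrite -(cells_memE witU cD Dy).
exists (cell y); last exact: cell_of_self.
by split; [exact: cells_cell_of|apply/least_leP; exists m].
Qed.

Lemma nbhd_reach x y : nbhd_rel x y -> reach x y.
Proof.
move=> /nbhd_relE[m [_ [y' w /cell_reach]]]; apply: reach_trans.
exact: walk_reach w.
Qed.

Lemma borel_rel_nbhd : borel_rel nbhd_rel.
Proof.
apply: borel_rel_iff (fun x y => iff_sym (nbhd_relE x y)) _.
apply: borel_rel_ex => m; apply: borel_rel_and; first exact: borel_rel_cst.
apply: borel_rel_comp => //; first exact: borel_rel_walk.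
by move=> x y; exact: walk_reach.
Qed.

Lemma borel_rel_cell : borel_rel cell.
Proof. exact: bor_cell. Qed.

End word_relations.

(** * Finite patterns determine the color *)

Lemma sgen_finitely_decided (X H : Type) (G : set (set X)) (J : finType)
    (B : J -> set X) (S : set X) (c : X -> H) (A : set H) :
  (forall j, <<s G >> (B j)) -> <<s G >> S ->
  (forall x x', S x -> S x' -> (forall j, B j x <-> B j x') -> c x = c x') ->
  <<s G >> [set x | S x /\ A (c x)].
Proof.
move=> GB GS dec.
(* On [S] the function [c] is constant on each of the finitely many atoms, so the set is the union
   of the atoms in [S] containing some point with value in [A]. *)
pose atom (t : {ffun J -> bool}) x := forall j, (B j x -> t j) /\ (t j ->
  B j x).
apply: (@sgen_iff _ _ (fun x => exists t,
    (exists x0, [/\ S x0, A (c x0) & atom t x0]) /\ (S x /\ atom t x))).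
  move=> x; split=> [[t [[x0 [Sx0 Ax0 tx0]] [Sx tx]]]|[Sx Ax]].
    split=> //; rewrite (dec x x0)// => j; have [h1 h2] := tx j;
      have [h3 h4] := tx0 j.
    by split=> [/h1/h4|/h3/h2].
  exists [ffun j => `[< B j x >]].
  have tx : atom [ffun j => `[< B j x >]] x by move=> j; rewrite ffunE;
    split=> /asboolP.
  by split=> //; exists x.
apply: sgen_ex => t; apply: sgen_when => _; apply: sgen_and => //.
apply: sgen_all => j; apply: sgen_and; apply: sgen_imp.
- exact: GB.
- exact: sgen_cst.
- exact: sgen_cst.
- exact: GB.
Qed.

Section local_pattern.
Context {T : topologicalType} (F : nat -> T -> T) {L : language} (G :
  sgraph L T)
  {s : nat} (r : nat) (U : 'I_s.+1 -> set T) (witU : asi_witness G r U) (n :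
    nat)
  (lt : T -> T -> Prop) (linlt : linear_order lt) (A : asi_algorithm s).
Local Notation M := (wmap F).
Local Notation W := (nbhd_rel G r U n).
Local Notation cell := (cell_of G r U).

(** The empty word stands for [x] itself. Completeness is stated over words rather than points,
    which makes it a countable condition. *)
Definition enumerates (ws : seq (seq nat)) x :=
  [/\ [::] \in ws, forall w, w \in ws -> W x (M w x) &
      forall u, W x (M u x) -> exists2 w, w \in ws & M u x = M w x].

(** Matching [wmap F w x] with [wmap F w x'] for [w] in [ws] is an isomorphism between the two local
    inputs, under which the algorithm is invariant. *)
Lemma asi_coloring_pattern ws x x' :
  (forall x y, W x y -> reach F x y) ->
  enumerates ws x -> enumerates ws x' ->
  {in ws &, forall w v, M w x = M v x <-> M w x' = M v x'} ->
  {in ws &, forall w v, adj G (M w x) (M v x) <-> adj G (M w x') (M v x')} ->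
  {in ws &, forall w v, lt (M w x) (M v x) <-> lt (M w x') (M v x')} ->
  (forall i, {in ws, forall w, U i (M w x) <-> U i (M w x')}) ->
  {in ws, forall w, cell x (M w x) <-> cell x' (M w x')} ->
  (forall R (g : 'I_(arity R) -> seq nat), (forall i, g i \in ws) ->
    rels G R (fun i => M (g i) x) <-> rels G R (fun i => M (g i) x')) ->
  asi_coloring witU n linlt A x = asi_coloring witU n linlt A x'.
Proof.
move=> Wreach [nilws wsW Wws] [_ wsW' Wws'] eqM adjM ltM UM cellM relM.
have /choice[f fP] : forall y : cell_nbhd G r U n (cell x),
    exists y' : cell_nbhd G r U n (cell x'),
    exists2 w, w \in ws & val y = M w x /\ val y' = M w x'.
  move=> [y /= yW]; have Wy : W x y by exact: set_mem.
  have [u yu] := Wreach _ _ Wy; have [|w wws uw] := Wws u; first by rewrite -yu.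
  exists (exist _ (M w x') (mem_set (wsW' w wws))); exists w => //=.
  by rewrite yu.
have /choice[g gP] : forall y' : cell_nbhd G r U n (cell x'),
    exists y : cell_nbhd G r U n (cell x),
    exists2 w, w \in ws & val y = M w x /\ val y' = M w x'.
  move=> [y /= yW]; have Wy : W x' y by exact: set_mem.
  have [u yu] := Wreach _ _ Wy; have [|w wws uw] := Wws' u;
    first by rewrite -yu.
  exists (exist _ (M w x) (mem_set (wsW w wws))); exists w => //=.
  by rewrite yu.
apply: (@asi_run_iso _ A _ _ _ _ _ f); last first.
  (* The empty word shows that the isomorphism sends [x] to [x']. *)
  apply: val_inj => /=; set y := (X in f X); have [w wws [xw ->]] := fP y.
  by apply/esym/(eqM [::] w).
split.
- split.
  + exists g => [y|y'].
      have [w wws [yw fw]] := fP y; have [v vws [gv fv]] := gP (f y).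
      by apply: val_inj; rewrite gv yw; apply/eqM => //; rewrite -fv fw.
    have [v vws [gv fv]] := gP y'; have [w wws [yw fw]] := fP (g y').
    by apply: val_inj; rewrite fw fv; apply/eqM => //; rewrite -yw gv.
  + move=> y z; have [w wws [yw fw]] := fP y; have [v vws [zv fv]] := fP z.
    by rewrite /= /induced_adj /= yw zv fw fv; exact: adjM.
  + move=> R v /=.
    have /choice[w wP] : forall i, exists w, w \in ws /\ (val (v i) = M w x /\
      val (f (v i)) = M w x').
      by move=> i; have [w] := fP (v i); exists w.
    have -> : (fun i => val (v i)) = (fun i => M (w i) x).
      by apply/funext => i; have [_ []] := wP i.
    have -> : (fun i => val (f (v i))) = (fun i => M (w i) x').
      by apply/funext => i; have [_ []] := wP i.
    by apply: relM => i; have [] := wP i.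
- move=> y z; have [w wws [yw fw]] := fP y; have [v vws [zv fv]] := fP z.
  by rewrite /= yw zv fw fv; exact: ltM.
- by move=> i y; have [w wws [yw fw]] := fP y; rewrite /= yw fw; exact: UM.
- by move=> y; have [w wws [yw fw]] := fP y; rewrite /= yw fw; exact: cellM.
Qed.

End local_pattern.

Lemma enumerates_exists (T : topologicalType) (F : nat -> T -> T) (L : language)
    (G : sgraph L T) (s r : nat) (U : 'I_s.+1 -> set T) (n : nat) x :
  asi_witness G r U -> (forall x y, nbhd_rel G r U n x y -> reach F x y) ->
  exists ws, enumerates F G r U n ws x.
Proof.
move=> witU Wreach.
have /finite_seqP[t tE] := cell_nbhd_finite witU n (cells_cell_of witU x).
have tW y : y \in t <-> nbhd_rel G r U n x y by rewrite /nbhd_rel tE.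
have /choice[wd wdP] : forall y, exists w, nbhd_rel G r U n x y ->
  y = wmap F w x.
  move=> y; have [/Wreach[w ->]|h] := pselect (nbhd_rel G r U n x y).
    by exists w.
  by exists [::].
exists ([::] :: map wd t); split.
- by rewrite inE eqxx.
- move=> w; rewrite inE => /orP[/eqP->|/mapP[y /tW Wy ->]].
    exact: cell_nbhd_self.
  by rewrite -wdP.
- move=> u Wu; exists (wd (wmap F u x)); last exact: wdP.
  by rewrite inE map_f ?orbT//; apply/tW.
Qed.

Lemma borel_asi_coloring (T : topologicalType) (code : T -> baire)
    (codeT : coding code) (L : language) (G : sgraph L T) (s r n : nat)
    (U : 'I_s.+1 -> set T) (witU : asi_witness G r U) (A : asi_algorithm s) :
  borel_sgraph G -> (forall i, borel (U i)) ->
  borel_coloring (asi_coloring witU n (code_lt_linear codeT) A).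
Proof.
move=> [badj brel] borU.
have [F bF FP] := borel_locally_finite_cover codeT badj (@adj_locally_finite _ _
  G).
have bM w := borel_wmap bF w.
have beq : borel_rel F eq by move=> w v; exact: (borel_map_eq codeT).
have bAdj : borel_rel F (adj G).
  by move=> w v; exact: (borel_map_rel codeT (bM w) (bM v) badj).
have rAdj x y : adj G x y -> reach F x y.
  by move=> /FP[k ->]; exists [:: k].
have rW := nbhd_reach witU rAdj.
have bW := borel_rel_nbhd bF beq witU n borU bAdj rAdj.
have bC := borel_rel_cell bF beq r borU bAdj rAdj.
move=> B; set c := asi_coloring _ _ _ _.
apply: (@sgen_iff _ _ (fun x => exists ws, enumerates F G r U n ws x /\
  B (c x))).
  move=> x; split=> [[ws []]//|Bx].
  by have [ws wsP] := enumerates_exists x witU (rW n); exists ws.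
apply: sgen_ex => ws; pose K := 'I_(size ws).
pose word (i : K) := nth [::] ws i.
(* An index for each atomic fact about the listed points; the type is finite because [ws] and the
   language are. *)
pose J : finType := ((K * K) + ((K * K) + ((K * K) + (('I_s.+1 * K) +
  (K + {R : symbol L & {ffun 'I_(arity R) -> K}})))))%type.
pose fact (j : J) : set T := match j with
  | inl p => [set x | wmap F (word p.1) x = wmap F (word p.2) x]
  | inr (inl p) => [set x | adj G (wmap F (word p.1) x) (wmap F (word p.2) x)]
  | inr (inr (inl p)) =>
      [set x | @code_lt T code (wmap F (word p.1) x) (wmap F (word p.2) x)]
  | inr (inr (inr (inl p))) => [set x | U p.1 (wmap F (word p.2) x)]
  | inr (inr (inr (inr (inl i)))) =>
      [set x | cell_of G r U x (wmap F (word i) x)]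
  | inr (inr (inr (inr (inr g)))) =>
      [set x | rels G (tag g) (fun i => wmap F (word (tagged g i)) x)]
  end.
have wordP w : w \in ws -> exists i : K, w = word i.
  move=> wws; have lt : index w ws < size ws by rewrite index_mem.
  by exists (Ordinal lt); rewrite /word nth_index.
apply: (@sgen_finitely_decided _ _ _ J fact).
- case=> [p|[p|[p|[p|[i|g]]]]] /=.
  + exact: beq.
  + exact: bAdj.
  + exact: (borel_map_lt codeT).
  + exact: (bM _ _ (borU _)).
  + exact: (bC [::]).
  + exact: (borel_map_tuple codeT (fun i =>
      bM (word (tagged g i))) (brel (tag g))).
- apply: (@sgen_iff _ _ (fun x => [::] \in ws /\
      ((forall w, w \in ws -> nbhd_rel G r U n x (wmap F w x)) /\
       forall u, nbhd_rel G r U n x (wmap F u x) ->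
         exists w, w \in ws /\ wmap F u x = wmap F w x))).
    move=> x; split=> [[h1 [h2 h3]]|[h1 h2 h3]].
      by split=> // u /h3[w []]; exists w.
    by split=> //; split=> // u /h3[w]; exists w.
  apply: sgen_and; first exact: sgen_cst.
  apply: sgen_and.
    apply: sgen_all => w; apply: sgen_imp; first exact: sgen_cst.
    exact: (bW [::]).
  apply: sgen_all => u; apply: sgen_imp; first exact: (bW [::]).
  by apply: sgen_ex => w; apply: sgen_and; [exact: sgen_cst|exact: beq].
move=> x x' ex ex' eqf; apply: asi_coloring_pattern (rW n) ex ex' _ _ _ _ _ _.
- by move=> _ _ /wordP[i ->] /wordP[j ->]; exact: (eqf (inl (i, j))).
- by move=> _ _ /wordP[i ->] /wordP[j ->]; exact: (eqf (inr (inl (i, j)))).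
- by move=> _ _ /wordP[i ->] /wordP[j ->];
    exact: (eqf (inr (inr (inl (i, j))))).
- by move=> a _ /wordP[i ->]; exact: (eqf (inr (inr (inr (inl (a, i)))))).
- by move=> _ /wordP[i ->]; exact: (eqf (inr (inr (inr (inr (inl i)))))).
- move=> R g gws; have /choice[h hP] : forall i, exists k : K, g i = word k.
    by move=> i; exact: wordP.
  pose tg := Tagged (fun R : symbol L => {ffun 'I_(arity R) -> K}) (finfun h).
  have gE z : (fun i => wmap F (g i) z) = (fun i =>
    wmap F (word (tagged tg i)) z).
    by apply/funext => i; rewrite hP ffunE.
  rewrite !gE.
  exact: (eqf (inr (inr (inr (inr (inr tg)))))).
Qed.

(** * From the separation index to a Borel coloring *)

(** The separation index may be smaller than [s], whereas the algorithm expects exactly [s.+1]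
    pieces; the missing ones are taken empty. *)
Lemma asi_witness_widen (L : language) (V : Type) (G : sgraph L V) (m s r : nat)
    (U : 'I_m.+1 -> set V) : m <= s -> asi_witness G r U ->
  asi_witness G r (fun j : 'I_s.+1 => if j <= m then U (inord j) else set0).
Proof.
move=> ms [[triv cov] fin]; split; first split.
- move=> i j _ _ [x []]; case: ifP => // im Ui; case: ifP => // jm Uj.
  apply: val_inj; have := triv _ _ I I (ex_intro _ x (conj Ui Uj)).
  by move=> /(congr1 val); rewrite /= !inordK.
- apply/seteqP; split=> // x _;
    have [i _ Ui] : (\bigcup_i U i) x by rewrite cov.
  have im : i <= m by rewrite -ltnS.
  exists (inord i) => //; rewrite inordK ?im ?inord_val// ltnS.
  exact: leq_trans im ms.
- move=> j x; case: ifP => // jm Ux.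
  have -> : piece_graph G r (fun j : 'I_s.+1 =>
    if j <= m then U (inord j) else set0) j =
      piece_graph G r U (inord j).
    by rewrite /piece_graph jm.
  exact: fin.
Qed.

Theorem theorem2p9 (R : realType) (s : nat) (P : coloring_problem) :
  ASI s P -> asi R s P.
Proof.
move=> [A [n [r solves]]] L T G polT borG GammaG /least_leP[m ms /(_ r)[U [witU
  borU]]].
(* The coding requires a base point, so the empty space is treated apart. *)
have [[x0 _]|noT] := pselect (exists x : T, True); last first.
  have lin : linear_order (fun _ _ : T => False).
    by split=> // x; case: noT; exists x.
  exists (asi_coloring (asi_witness_widen ms witU) n lin A); last exact: solves.
  move=> B; rewrite (_ : _ @^-1` B = set0); first exact: sigma_algebra0.
  by apply/seteqP; split=> x; case: noT; exists x.
have [code codeT] := polish_coding polT x0.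
exists (asi_coloring (asi_witness_widen ms witU) n (code_lt_linear codeT) A);
  last exact: solves.
apply: borel_asi_coloring => // i; case: ifP => _; first exact: borU.
exact: sigma_algebra0.
Qed.
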